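(* Let $\delta\in(0,2)$, $x>0$ and $t\ge 0$, and put $\alpha=1-\frac{\delta}{2}\in(0,1)$. Let $X$ be a Bessel process of dimension $\delta$ (without drift) started at $x$ (law $\mathbb{P}_x^{\delta}$), and let $d_t=\inf\{s\ge t:X_s=0\}$ be its first zero after time $t$. Let $A_\alpha$ and $E_x$ be independent random variables, with $A_\alpha$ having the $\mathrm{Beta}(\alpha,1-\alpha)$ distribution and $E_x$ the exponential distribution with rate $\frac12x^2$. Then $d_t$ under $\mathbb{P}_x^{\delta}$ has the same distribution as $$\max\left\{t,\frac{1}{E_x}\right\}\frac{1}{A_\alpha}.$$
   Context: Distributions: $\mathrm{Beta}(\alpha,1-\alpha)$ has density $\frac{y^{\alpha-1}(1-y)^{-\alpha}}{\Gamma(\alpha)\Gamma(1-\alpha)}\mathbf 1_{(0,1)}(y)$; an exponential random variable with rate $\lambda$ has density $\lambda e^{-\lambda s}\mathbf 1_{[0,\infty)}(s)$. For $\delta\in(0,2)$, the Bessel process of dimension $\delta$ is the usual one: the diffusion on $[0,\infty)$ with generator $\frac12\frac{d^2}{dx^2}+\frac{\delta-1}{2x}\frac{d}{dx}$ for which $0$ is a regular boundary with instantaneous reflection. $\mathbb{P}_x^{\delta}$ denotes its law when started at $x\ge0$. *)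

(* Defs.v *)
From HB Require Import structures.
From mathcomp Require Import all_boot all_order all_algebra.
From mathcomp Require Import all_classical all_reals all_analysis.
From mathcomp Require Import measurable_realfun.
Set Implicit Arguments.
Unset Strict Implicit.
Unset Printing Implicit Defensive.
Import Order.TTheory GRing.Theory Num.Theory.
Import numFieldNormedType.Exports.
Local Open Scope classical_set_scope.
Local Open Scope ring_scope.

Definition Gamma_fun (R : realType) (a : R) : R :=
  \int[lebesgue_measure]_(u in `]0, +oo[) (u `^ (a - 1) * expR (- u)).

(* The library's [beta_pdf] only has natural-number parameters. *)
Definition beta_one_minus_pdf (R : realType) (a y : R) : R :=
  (y `^ (a - 1) * (1 - y) `^ (- a) / (Gamma_fun a * Gamma_fun (1 - a)))
  * \1_(`]0, 1[ : set R) y.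

Definition has_density d (T : measurableType d) (R : realType)
    (P : probability T R) (X : {RV P >-> R}) (f : R -> R) : Prop :=
  forall B : set R, measurable B ->
    distribution P X B = (\int[lebesgue_measure]_(y in B) (f y)%:E)%E.

Definition independent_RV2 d (T : measurableType d) (R : realType)
    (P : probability T R) (X Y : {RV P >-> R}) : Prop :=
  forall B C : set R, measurable B -> measurable C ->
    P (X @^-1` B `&` Y @^-1` C) = (P (X @^-1` B) * P (Y @^-1` C))%E.

(* Measurability is part of the definition because [P] is only meaningful on
   measurable sets. *)
Definition same_distribution d1 d2 (T1 : measurableType d1)
    (T2 : measurableType d2) (R : realType) (P : probability T1 R)
    (Q : probability T2 R) (Y : T1 -> \bar R) (Z : T2 -> \bar R) : Prop :=
  [/\ measurable_fun [set: T1] Y, measurable_fun [set: T2] Z &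
      forall B : set (\bar R), measurable B ->
        P (Y @^-1` B) = Q (Z @^-1` B)].

(* The state space [0, +oo[ is a subset of R: values of functions on ]-oo, 0[,
   and kernels [p t y] with [y < 0] or [t < 0], are irrelevant everywhere. *)

Definition C0_halfline (R : realType) (f : R -> R) : Prop :=
  {within `[0, +oo[, continuous f} /\ f z @[z --> +oo] --> (0 : R).

Definition semigroup_op (R : realType) (p : R -> R.-pker R ~> R) (t : R)
    (f : R -> R) (y : R) : R :=
  \int[p t y]_(z in `[0, +oo[) f z.

(* The sup norm over [0, +oo[ of [F t] tends to 0 as t decreases to 0. *)
Definition unif_cvg0 (R : realType) (F : R -> R -> R) : Prop :=
  forall e : R, 0 < e ->
    \forall t \near 0^'+, forall y, 0 <= y -> `|F t y| <= e.

Definition feller_transition_function (R : realType)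
    (p : R -> R.-pker R ~> R) : Prop :=
  [/\ forall t y, 0 <= t -> 0 <= y -> p t y `[0, +oo[%classic = 1%E,
      forall y (B : set R), 0 <= y -> measurable B -> p 0 y B = \d_y B,
      forall s t y (B : set R), 0 <= s -> 0 <= t -> 0 <= y -> measurable B ->
        p (s + t) y B = (\int[p s y]_(z in `[0%R, +oo[) p t z B)%E,
      forall t f, 0 <= t -> C0_halfline f -> C0_halfline (semigroup_op p t f) &
      forall f, C0_halfline f ->
        unif_cvg0 (fun t y => semigroup_op p t f y - f y)].

(* Graph of the infinitesimal generator: f lies in its domain, with image g. *)
Definition infinitesimal_generator (R : realType) (p : R -> R.-pker R ~> R)
    (f g : R -> R) : Prop :=
  [/\ C0_halfline f, C0_halfline g &
      unif_cvg0 (fun t y => (semigroup_op p t f y - f y) / t - g y)].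

(* Graph of the operator f |-> f''/2 + (delta - 1)/(2 y) f' with the boundary
   condition for instantaneous reflection at 0: the derivative f'/s' of f with
   respect to the scale function s, s'(y) = y^(1 - delta), vanishes at 0+.
   (Absorption would require g 0 = 0 instead; a sticky boundary would make the
   limit a positive multiple of g 0.)  The second derivative is continuous on
   ]0, +oo[ because g is. *)
Definition reflecting_bessel_operator (R : realType) (delta : R)
    (f g : R -> R) : Prop :=
  [/\ C0_halfline f, C0_halfline g,
      forall y, 0 < y ->
        [/\ derivable f y 1, derivable (derive1 f) y 1 &
            g y = derive1 (derive1 f) y / 2 + (delta - 1) / (2 * y) * derive1 f y] &
      derive1 f y / y `^ (1 - delta) @[y --> 0^'+] --> (0 : R)].

Definition bessel_transition_function (R : realType) (delta : R)
    (p : R -> R.-pker R ~> R) : Prop :=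
  feller_transition_function p /\
  forall f g, infinitesimal_generator p f g <->
              reflecting_bessel_operator delta f g.

Definition natural_filtration (R : realType) d (T : measurableType d)
    (X : R -> T -> R) (s : R) : set (set T) :=
  <<s [set F | exists r (B : set R),
         [/\ 0 <= r, r <= s, measurable B & F = X r @^-1` B] ]>>.

(* P(X_(s+t) \in B | F_s) = p t X_s B, conditional probabilities being spelled
   out by integration over the events of F_s. *)
Definition markov_process (R : realType) d (T : measurableType d)
    (P : probability T R) (p : R -> R.-pker R ~> R)
    (X : R -> {RV P >-> R}) : Prop :=
  forall s t (F : set T) (B : set R), 0 <= s -> 0 <= t ->
    natural_filtration X s F -> measurable B ->
    P (F `&` X (s + t) @^-1` B) = (\int[P]_(w in F) p t (X s w) B)%E.

(* Only the times t >= 0 of the family X matter. *)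
Definition bessel_process (R : realType) (delta x : R) d
    (T : measurableType d) (P : probability T R)
    (X : R -> {RV P >-> R}) : Prop :=
  [/\ forall t w, 0 <= t -> 0 <= X t w,
      forall w, {within `[0, +oo[, continuous (fun t => X t w)},
      P [set w | X 0 w = x] = 1%E &
      exists p : R -> R.-pker R ~> R,
        bessel_transition_function delta p /\ markov_process p X].

(* +oo when there is no zero after time t. *)
Definition first_zero_after (R : realType) (T : Type) (X : R -> T -> R)
    (t : R) (w : T) : \bar R :=
  ereal_inf [set s%:E | s in [set s : R | t <= s /\ X s w = 0]].

(* Main.v *)
Require Import Defs.
From HB Require Import structures.
From mathcomp Require Import all_boot all_order all_algebra.
From mathcomp Require Import all_classical all_reals all_analysis.
From mathcomp Require Import measurable_realfun.
From mathcomp Require Import ring lra.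
Import Order.TTheory GRing.Theory Num.Theory.
Import numFieldNormedType.Exports.
Local Open Scope classical_set_scope.
Local Open Scope ring_scope.

(** Put [c = delta / 2 = 1 - alpha].  For [m > 0] the function
    [y |-> m ^ (-c) * exp (- y^2 / (2 m))], called [bheat c m] below, is the
    transition density of the process from [y] to [0] after time [m], relative
    to the speed measure and up to a constant factor.  It lies in the domain of
    the reflecting Bessel operator, which acts on it as the time derivative
    d/dm.  Hence the semigroup at time [t] sends [bheat c m] to
    [bheat c (m + t)] ([semigroup_bheat]).

    Let [f] be the Beta(1 - c, c) density and
    [gmix f r y = int f(b) exp (- y^2 / (2 r b)) db], the candidate for the
    probability that the process started at [y] meets [0] before time [r].
    Applying the semigroup at time [h] to [gmix f r] and substituting
    [b' = (r b + h) / (r + h)] yields the integral that defines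
    [gmix f (r + h)], restricted to [b' > h / (r + h)] ([semigroup_gmix]).
    This truncated integral, [gmix_tail f h r], has two uses.

    - Integrating over the value of [A] shows that [gmix_tail f t (s - t) x] is
      the probability that [max (t, 1/E) / A <= s] ([max_ratio_cdf]); by the
      Markov property it is also the mean of [gmix f (s - t) (X t)].

    - The truncation loses a nonnegative amount, at most [exp (- e^2 / (2 h))]
      at points [y >= e].  So, read along a grid of mesh [h], the process
      [gmix f (s - u) (X u)] is a martingale up to tiny errors as long as [X]
      stays above [e].  It is close to [1] at the first grid point where
      [X < e], and negligible if no such point occurs before [s].
      Summing over the grid compares its initial mean with the probability
      that [X < e] somewhere on the grid: it is at least almost that
      probability if some time is left after the last grid point
      ([grid_lower]), and at most that probability plus the errors if the grid
      reaches [s] ([grid_upper]).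

    Refining dyadic grids with [n] intervals, the total error
    [n * exp (- e^2 n / (2 (s - t)))] vanishes; then [e] tends to [0] and, by
    continuity of the paths, for [t <= u < s],
    P(zero in [t, u]) <= P(max (t, 1/E) / A <= s) <= P(zero in [t, s])
    ([zero_in_le], [zero_in_ge]).  The outer terms are values of the
    distribution function of [d_t].  As distribution functions are
    right-continuous, the two coincide, and they determine the laws on the
    extended real line ([eq_law_ereal]). *)

(** * Integration against a mixture of measures *)

Section mixture.
Local Open Scope ereal_scope.
Context d1 d2 (X : measurableType d1) (Y : measurableType d2) (R : realType).

Import HBNNSimple.

(** The identity for indicators is the hypothesis; simple functions follow by
    linearity and the general case by monotone convergence.  It turns the
    set-wise forms of the Chapman-Kolmogorov equation, of the Markov property
    and of densities into statements about functions. *)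
Lemma ge0_integral_mixture (mu : {measure set Y -> \bar R})
    (nu : {measure set X -> \bar R}) (D : set X)
    (k : X -> {measure set Y -> \bar R}) (f : Y -> \bar R) :
  measurable D ->
  (forall U, measurable U -> measurable_fun D (fun x => k x U)) ->
  (forall U, measurable U -> mu U = \int[nu]_(x in D) k x U) ->
  measurable_fun [set: Y] f -> (forall y, 0 <= f y) ->
  \int[mu]_y f y = \int[nu]_(x in D) \int[k x]_y f y.
Proof.
move=> mD mk muE mf f0.
have step (g : {nnsfun Y >-> R}) (m : {measure set Y -> \bar R}) :
    \int[m]_y (g y)%:E = \sum_(r \in range g) r%:E * m (g @^-1` [set r]).
  by rewrite integralT_nnsfun sintegralE.
have mstep (g : {nnsfun Y >-> R}) :
    measurable_fun D (fun x => \int[k x]_y (g y)%:E).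
  under eq_fun do rewrite step.
  apply: emeasurable_fsum => [|r]; first exact: fimfunP.
  apply: measurable_funeM.
  exact: mk.
have istep (g : {nnsfun Y >-> R}) :
    \int[mu]_y (g y)%:E = \int[nu]_(x in D) \int[k x]_y (g y)%:E.
  under [RHS]eq_integral do rewrite step.
  rewrite step ge0_integral_fsum//; first last.
  - move=> r x Dx.
    have := mulemu_ge0 (fun r => g @^-1` [set r]).
    by apply; exact: preimage_nnfun0.
  - by move=> r; apply: measurable_funeM; exact: mk.
  apply: eq_fsbigr => r; rewrite inE/= => -[y _ <-].
  by rewrite muE// ge0_integralZl//; [exact: mk|rewrite lee_fin].
pose g := nnsfun_approx measurableT mf.
have lim_int (m : {measure set Y -> \bar R}) :
    (\int[m]_y (g n y)%:E @[n --> \oo]) --> \int[m]_y f y.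
  have fE : f = fun y => lim ((g n y)%:E @[n --> \oo]).
    apply/funext => y; apply/esym/cvg_lim => //.
    by apply: cvg_nnsfun_approx => // x _; exact: f0.
  rewrite [X in _ --> X](_ : _ = \int[m]_y lim ((g n y)%:E @[n --> \oo])).
    apply: cvg_monotone_convergence => //.
    - by move=> n; exact/measurable_EFinP.
    - by move=> n y _; rewrite lee_fin.
    - by move=> y _ a b ab; rewrite lee_fin; exact/lefP/nd_nnsfun_approx.
  by rewrite {1}fE.
have := lim_int mu.
under eq_fun do rewrite istep.
have nd x : D x -> nondecreasing_seq (fun n => \int[k x]_y (g n y)%:E).
  move=> Dx a b ab; apply: ge0_le_integral => //.
  - by move=> y _; rewrite lee_fin.
  - exact/measurable_EFinP.
  - exact/measurable_EFinP.
  - by move=> y _; rewrite lee_fin; exact/lefP/nd_nnsfun_approx.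
have h := @cvg_monotone_convergence _ _ _ nu D mD
  (fun n x => \int[k x]_y (g n y)%:E) (fun n => mstep (g n)) _ nd.
have {}h := h _; move=> h1; have := cvg_lim (@ereal_hausdorff R) h1.
rewrite (cvg_lim (@ereal_hausdorff R) (h _)) => [<-|n x Dx].
  by apply: eq_integral => x _; apply: cvg_lim => //; exact: lim_int.
by apply: integral_ge0 => y _; rewrite lee_fin.
Qed.

End mixture.

(** * The Gaussian solutions of the Bessel heat equation *)

Section bessel_heat.
Context (R : realType).
Implicit Types c m z : R.

(** [m ^ (-c) * exp (- z^2 / (2 m))]; the power is written as an exponential so
    that one chain rule gives the derivatives in [m]. *)
Definition bheat c m z : R := expR (- (c * ln m) - z ^+ 2 / (2 * m)).
Definition dt_bheat c m z : R := bheat c m z * (z ^+ 2 / (2 * m ^+ 2) - c / m).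
Definition dtt_bheat c m z : R :=
  bheat c m z * ((z ^+ 2 / (2 * m ^+ 2) - c / m) ^+ 2
             - z ^+ 2 / m ^+ 3 + c / m ^+ 2).

Lemma is_derive_bheat_time c m z : 0 < m ->
  is_derive m 1 (fun m => bheat c m z) (dt_bheat c m z).
Proof.
move=> m0.
have hm : m != 0 by rewrite gt_eqF.
have hl : is_derive m (1:R) (@ln R) m^-1 by exact: is_derive1_ln.
have h2 : is_derive m (1:R) (fun m : R => 2 * m) 2.
  by apply: is_derive_eq; rewrite /GRing.scale/=; ring.
have hi : is_derive m (1:R) (fun m : R => (2 * m)^-1) (- (2 * m ^+ 2)^-1).
  have hh := @is_deriveV _ (fun m : R => 2 * m) m _ 1 _ h2.
  apply: is_derive_eq.
    by apply: hh; rewrite mulf_neq0.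
  by rewrite /GRing.scale/=; field.
rewrite /bheat /dt_bheat.
have he := @is_derive1_comp _ expR (fun m => - (c * ln m) - z ^+ 2 / (2 * m)) m _
  (z ^+ 2 / (2 * m ^+ 2) - c / m) (is_derive_expR _).
apply: he.
apply: is_derive_eq.
by rewrite /GRing.scale/=; field.
Qed.

Lemma is_derive_dt_bheat_time c m z : 0 < m ->
  is_derive m 1 (fun m => dt_bheat c m z) (dtt_bheat c m z).
Proof.
move=> m0.
have hm : m != 0 by rewrite gt_eqF.
have hq := is_derive_bheat_time c m z m0.
have h2 : is_derive m (1:R) (fun m : R => 2 * m ^+ 2) (4 * m).
  by apply: is_derive_eq; rewrite /GRing.scale/=; ring.
have hi : is_derive m (1:R) (fun m : R => (2 * m ^+ 2)^-1) (- (m ^+ 3)^-1).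
  have hh := @is_deriveV _ (fun m : R => 2 * m ^+ 2) m _ 1 _ h2.
  apply: is_derive_eq.
    by apply: hh; rewrite mulf_neq0// expf_neq0.
  by rewrite /GRing.scale/=; field.
have hi2 : is_derive m (1:R) (fun m : R => m^-1) (- (m ^+ 2)^-1).
  have hh := @is_deriveV _ (fun m : R => m) m _ 1 hm.
  apply: is_derive_eq.
  by rewrite /GRing.scale/=; field.
have hg : is_derive m (1:R) (fun m : R => z ^+ 2 / (2 * m ^+ 2) - c / m)
    (c / m ^+ 2 - z ^+ 2 / m ^+ 3).
  apply: is_derive_eq.
  by rewrite /GRing.scale/=; field.
have := @is_deriveM _ _ (fun m => bheat c m z) _ m _ _ _ hq hg.
rewrite /dtt_bheat /dt_bheat => h.
apply: is_derive_eq.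
by rewrite /GRing.scale/=; field.
Qed.

Lemma is_derive_bheat_space c m z : 0 < m ->
  is_derive z 1 (bheat c m) (- (z / m) * bheat c m z).
Proof.
move=> m0.
have hm : m != 0 by rewrite gt_eqF.
rewrite /bheat [X in is_derive _ _ _ X]mulrC.
have he := @is_derive1_comp _ expR (fun z => - (c * ln m) - z ^+ 2 / (2 * m)) z _
  (- (z / m)) (is_derive_expR _).
apply: he.
apply: is_derive_eq.
by rewrite /GRing.scale/=; field.
Qed.

Lemma is_derive2_bheat_space c m z : 0 < m ->
  is_derive z 1 (fun z => - (z / m) * bheat c m z)
    (((z / m) ^+ 2 - m^-1) * bheat c m z).
Proof.
move=> m0.
have hm : m != 0 by rewrite gt_eqF.
have hq := is_derive_bheat_space c m z m0.
have hg : is_derive z (1:R) (fun z => - (z / m)) (- m^-1).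
  apply: is_derive_eq.
  by rewrite /GRing.scale/=; field.
have := @is_deriveM _ _ _ _ z _ _ _ hg hq => h.
apply: is_derive_eq.
by rewrite /GRing.scale/=; field.
Qed.


Lemma sqr_expR_bound (w : R) : 0 <= w -> w ^+ 2 + 4 * w + 4 <= 4 * expR w.
Proof.
move=> w0; have h : 1 + w / 2 <= expR (w / 2) by exact: expR_ge1Dx.
have -> : expR w = expR (w / 2) ^+ 2.
  by rewrite -expRM_natl; congr expR; field.
have := ler_pM (_ : 0 <= 1 + w / 2) (_ : 0 <= 1 + w / 2) h h.
rewrite -!expr2 => /(_ _ _)/wrap[||]; [lra|lra|].
nra.
Qed.

Lemma bheatE c m z : bheat c m z = expR (- (c * ln m)) * expR (- (z ^+ 2 / (2 * m))).
Proof. by rewrite /bheat expRD. Qed.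

(** In terms of [w = z^2 / (2 m)], every quantity to be estimated is a quadratic
    polynomial in [w] times [exp (- w)]; this one bound covers them all. *)
Lemma bheat_le c m z (w := z ^+ 2 / (2 * m)) : 0 < m ->
  (w ^+ 2 + 4 * w + 4) * bheat c m z <= 4 * expR (- (c * ln m)).
Proof.
move=> m0; have w0 : 0 <= w.
  by rewrite /w mulr_ge0 ?sqr_ge0// invr_ge0 mulr_ge0// ltW.
rewrite bheatE -/w mulrCA [leRHS]mulrC ler_pM2l ?expR_gt0//.
by rewrite expRN ler_pdivrMr ?expR_gt0//; exact: sqr_expR_bound.
Qed.

Lemma dtt_bheat_bound c m : 0 <= c <= 1 -> 0 < m ->
  exists K : R, forall M z, m <= M -> `|dtt_bheat c M z| <= K.
Proof.
move=> /andP[c0 c1] m0.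
exists (4 * expR (- (c * ln m)) / m ^+ 2) => M z mM.
have M0 : 0 < M by exact: lt_le_trans mM.
pose w := z ^+ 2 / (2 * M).
have w0 : 0 <= w.
  by rewrite /w mulr_ge0 ?sqr_ge0// invr_ge0 mulr_ge0// ltW.
have -> : dtt_bheat c M z = ((w - c) ^+ 2 - 2 * w + c) * bheat c M z / M ^+ 2.
  by rewrite /dtt_bheat /w; field; rewrite gt_eqF.
rewrite normrM normrM (ger0_norm (expR_ge0 _)) (@ger0_norm _ (M ^+ 2)^-1)
  ?invr_ge0 ?sqr_ge0//.
apply: ler_pM.
- by rewrite mulr_ge0// expR_ge0.
- by rewrite invr_ge0 sqr_ge0.
- apply: (@le_trans _ _ ((w ^+ 2 + 4 * w + 4) * bheat c M z)).
    rewrite ler_wpM2r ?expR_ge0//.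
    rewrite ler_norml; apply/andP; split; nra.
  have /le_trans := bheat_le c M z M0; apply.
  rewrite ler_pM2l// ler_expR lerN2 ler_wpM2l// ler_ln//.
- by rewrite lef_pV2 ?posrE ?exprn_gt0// lerXn2r// nnegrE ltW.
Qed.

(** Differentiability in [m] holds uniformly in [z], which is what the sup norm
    of the semigroup demands. *)
Lemma bheat_taylor c m : 0 <= c <= 1 -> 0 < m -> exists K : R, forall h z, `|h| <= m / 2 ->
  `|bheat c (m + h) z - bheat c m z - h * dt_bheat c m z| <= K * h ^+ 2.
Proof.
move=> c01 m0; have [|K HK] := @dtt_bheat_bound c (m / 2) c01; first by lra.
have K0 : 0 <= K by apply: le_trans (HK m 0 _); [|lra].
have shrink (t h : R) : 0 <= t <= 1 -> `|h| <= m / 2 -> `|t * h| <= m / 2.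
  move=> /andP[t0 t1]; apply: le_trans.
  by rewrite normrM ger0_norm// ler_piMl.
have half (h : R) : `|h| <= m / 2 -> m / 2 <= m + h.
  by rewrite ler_norml => /andP[h1 h2]; lra.
(* The segment from [m] to [m + h] is parametrized by [[0, 1]], which treats
   both signs of [h] at once. *)
have mvt (f df : R -> R) (h : R) : `|h| <= m / 2 ->
    (forall x, m / 2 <= x -> is_derive x 1 f (df x)) ->
    exists2 t : R, 0 <= t <= 1 & f (m + h) - f m = df (m + t * h) * h.
  move=> hm fd.
  have gd (t : R) : t \in `[0, 1] ->
      is_derive t 1 (fun t => f (m + t * h)) (df (m + t * h) * h).
    rewrite in_itv/= => t01.
    have ht : m / 2 <= m + t * h by apply: half; exact: shrink.
    apply: (@is_derive1_comp _ f (fun t => m + t * h)).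
      exact: fd.
    by apply: is_derive_eq; rewrite /GRing.scale/=; ring.
  have gd' (t : R) : t \in `]0, 1[ ->
      is_derive t 1 (fun t => f (m + t * h)) (df (m + t * h) * h).
    by move=> t01; apply: gd; exact: subset_itv_oo_cc.
  have gc : {within `[(0:R), 1], continuous (fun t => f (m + t * h))}.
    apply: derivable_within_continuous => t t01.
    by have := gd t t01; case.
  have [t] := MVT_segment ler01 gd' gc.
  rewrite in_itv/= subr0 mulr1 mul1r mul0r addr0 => t01 e.
  by exists t.
exists K => h z hm.
have [|t t01 ->] := mvt (fun m => bheat c m z) (fun m => dt_bheat c m z) h hm.
  by move=> x hx; apply: is_derive_bheat_time; lra.
have thm := shrink t h t01 hm.
have [|s s01 e] := mvt (fun m => dt_bheat c m z) (fun m => dtt_bheat c m z) (t * h) thm.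
  by move=> x hx; apply: is_derive_dt_bheat_time; lra.
have -> : dt_bheat c (m + t * h) z * h - h * dt_bheat c m z =
    h * (dt_bheat c (m + t * h) z - dt_bheat c m z) by ring.
rewrite e (normrM h) (normrM (dtt_bheat _ _ _)) (normrM t).
have Kb := HK (m + s * (t * h)) z (half _ (shrink s _ s01 thm)).
apply: (@le_trans _ _ (`|h| * (K * `|h|))); last first.
  by rewrite mulrCA -expr2 real_normK ?num_real.
rewrite ler_wpM2l// ler_pM//.
by case/andP: t01 => t0 t1; rewrite (ger0_norm t0) ler_piMl.
Qed.


Lemma C0_halfline_decay (f : R -> R) (K : R) : continuous f ->
  (forall z, 0 < z -> `|f z| <= K / z ^+ 2) -> C0_halfline f.
Proof.
move=> fc fK; split; first exact: continuous_subspaceT.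
apply/cvgr0Pnorm_le => e e0; near=> z.
have z1 : 1 <= z by near: z; apply: nbhs_pinfty_ge; rewrite num_real.
have zK : `|K| / e <= z by near: z; apply: nbhs_pinfty_ge; rewrite num_real.
have z0 : 0 < z by exact: lt_le_trans z1.
apply: le_trans (fK z z0) _.
rewrite ler_pdivrMr ?exprn_gt0//.
move: zK; rewrite ler_pdivrMr// => zK.
apply: le_trans (ler_norm _) _; apply: le_trans zK _.
by rewrite mulrC ler_pM2l// expr2 ler_peMl// ltW.
Unshelve. all: by end_near. Qed.

Lemma bheat_continuous c m : 0 < m -> continuous (bheat c m).
Proof.
move=> m0 z; apply: differentiable_continuous; apply/derivable1_diffP.
by have := is_derive_bheat_space c m z m0; case.
Qed.

Lemma dt_bheat_continuous c m : 0 < m -> continuous (dt_bheat c m).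
Proof.
move=> m0 z; apply: cvgM; first exact: bheat_continuous.
apply: cvgB; last exact: cvg_cst.
by apply: cvgMl; exact: exprn_continuous.
Qed.

Lemma bheat_C0 c m : 0 < m -> C0_halfline (bheat c m).
Proof.
move=> m0; apply: (@C0_halfline_decay _ (2 * m * expR (- (c * ln m)))).
  exact: bheat_continuous.
move=> z z0; rewrite ger0_norm ?expR_ge0// ler_pdivlMr ?exprn_gt0//.
have := bheat_le c m z m0.
set w := z ^+ 2 / (2 * m); have zw : z ^+ 2 = 2 * m * w.
  by rewrite /w; field; rewrite gt_eqF.
have w0 : 0 <= w.
  by rewrite /w mulr_ge0 ?sqr_ge0// invr_ge0 mulr_ge0// ltW.
move=> h; rewrite zw mulrCA ler_pM2l ?mulr_gt0//.
have := expR_ge0 (- (c * ln m) - z ^+ 2 / (2 * m)); rewrite -/(bheat c m z) => q0.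
have : 4 * w * bheat c m z <= (w ^+ 2 + 4 * w + 4) * bheat c m z.
  by rewrite ler_wpM2r//; nra.
by lra.
Qed.

Lemma dt_bheat_C0 c m : 0 <= c <= 1 -> 0 < m -> C0_halfline (dt_bheat c m).
Proof.
move=> /andP[c0 c1] m0; apply: (@C0_halfline_decay _ (8 * expR (- (c * ln m)))).
  exact: dt_bheat_continuous.
move=> z z0; rewrite ler_pdivlMr ?exprn_gt0//.
have := bheat_le c m z m0.
set w := z ^+ 2 / (2 * m); have zw : z ^+ 2 = 2 * m * w.
  by rewrite /w; field; rewrite gt_eqF.
have w0 : 0 <= w.
  by rewrite /w mulr_ge0 ?sqr_ge0// invr_ge0 mulr_ge0// ltW.
have -> : dt_bheat c m z = bheat c m z * (w - c) / m.
  by rewrite /dt_bheat /w; field; rewrite gt_eqF.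
have := expR_ge0 (- (c * ln m) - z ^+ 2 / (2 * m)); rewrite -/(bheat c m z) => q0 h.
rewrite normrM (@ger0_norm _ m^-1) ?invr_ge0 ?(ltW m0)// normrM (ger0_norm q0).
rewrite {1}zw.
have -> : bheat c m z * `|w - c| / m * (2 * m * w) = 2 * (w * `|w - c| * bheat c m z).
  by field; rewrite gt_eqF.
have -> : 8 * expR (- (c * ln m)) = 2 * (4 * expR (- (c * ln m))) by ring.
rewrite ler_pM2l//; apply: le_trans h; rewrite ler_wpM2r//.
have : `|w - c| <= w + 1 by rewrite ler_norml; apply/andP; split; lra.
by nra.
Qed.

(** Besides the heat equation this contains the boundary condition: the scale
    derivative at [y] is of order [y ^ (2 * c)], which vanishes at [0]. *)
Lemma reflecting_bessel_bheat c m : 0 < c <= 1 -> 0 < m ->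
  reflecting_bessel_operator (2 * c) (bheat c m) (dt_bheat c m).
Proof.
move=> /andP[c0 c1] m0.
have d1 : derive1 (bheat c m) = fun z => - (z / m) * bheat c m z.
  apply/funext => z; rewrite derive1E.
  by have := is_derive_bheat_space c m z m0; case.
have d2 : derive1 (fun z => - (z / m) * bheat c m z) =
    fun z => ((z / m) ^+ 2 - m^-1) * bheat c m z.
  apply/funext => z; rewrite derive1E.
  by have := is_derive2_bheat_space c m z m0; case.
have hm : m != 0 by rewrite gt_eqF.
split; [exact: bheat_C0|by apply: dt_bheat_C0; rewrite ?(ltW c0)| |].
- move=> y y0; split.
  + by have := is_derive_bheat_space c m y m0; case.
  + by rewrite d1; have := is_derive2_bheat_space c m y m0; case.
  + rewrite d1 d2 /dt_bheat; field.
    by rewrite hm/= gt_eqF.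
rewrite d1.
apply/cvgr0Pnorm_le => e e0.
pose K := expR (- (c * ln m)) / m.
have K0 : 0 < K by rewrite divr_gt0// expR_gt0.
have eK : 0 < e / K by rewrite divr_gt0.
have /cvgr0Pnorm_le/(_ _ eK) : (y `^ (2 * c) @[y --> (0:R)^'+] --> (0:R)).
  by apply: powR_cvg0; rewrite mulr_gt0.
have : \forall y \near (0:R)^'+, 0 < y by exact: nbhs_right_gt.
apply: filterS2 => y y0.
rewrite ger0_norm ?powR_ge0// ler_pdivlMr// => h.
apply: le_trans h.
have -> : - (y / m) * bheat c m y / y `^ (1 - 2 * c) = - (y `^ (2 * c) * (bheat c m y / m)).
  have -> : y `^ (2 * c) = y / y `^ (1 - 2 * c).
    rewrite -[X in X / _]powRr1 ?ltW// -powRB ?gt_eqF//.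
      by congr (_ `^ _); ring.
    by lra.
  by ring.
rewrite normrN ger0_norm; last first.
  by rewrite mulr_ge0 ?powR_ge0// divr_ge0 ?expR_ge0// ltW.
rewrite ler_wpM2l ?powR_ge0// /K ler_pM2r ?invr_gt0// /bheat ler_expR.
by rewrite lerBlDr lerDl divr_ge0 ?sqr_ge0// mulr_ge0// ltW.
Qed.

End bessel_heat.

Arguments bheat {R}.
Arguments dt_bheat {R}.

(** * Feller semigroups on the half-line *)

Section semigroup.
Context (R : realType) (p : R -> R.-pker R ~> R).
Hypothesis fp : feller_transition_function p.
Implicit Types (f g : R -> R) (s t y z h e c m : R).

Let itv0_measurable : measurable (`[0, +oo[%classic : set R).
Proof. exact: measurable_itv. Qed.

Lemma C0_halfline_bounded f : C0_halfline f ->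
  exists2 K : R, 0 <= K & forall z, 0 <= z -> `|f z| <= K.
Proof.
move=> [fc /cvgr0Pnorm_le/(_ 1 ltr01)] [M [Mr HM]].
pose M1 := `|M| + 1.
have M1M : M < M1 by rewrite /M1 (le_lt_trans (ler_norm M))// ltrDl.
have : compact (f @` `[0, M1]).
  apply: continuous_compact; last exact: segment_compact.
  by apply: continuous_subspaceW fc; exact: subset_itvl.
move=> /compact_bounded/ex_strict_bound_gt0[K K0 HK].
exists (K + 1); first by rewrite addr_ge0// ltW.
move=> z z0; have [zM|Mz] := leP z M1.
  apply: ltW; rewrite (lt_trans (HK _ _)) ?ltrDl//; exists z => //=.
  by rewrite in_itv/= z0.
by apply: (le_trans (HM z (lt_trans M1M Mz))); rewrite lerDr ltW.
Qed.

Lemma C0_halfline_measurable f : C0_halfline f -> measurable_fun (`[0, +oo[%classic : set R) f.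
Proof. by move=> [fc _]; exact: subspace_continuous_measurable_fun. Qed.

Lemma C0_halfline_integrable t y f : C0_halfline f ->
  (p t y).-integrable (`[0, +oo[%classic : set R) (EFin \o f).
Proof.
move=> f0; apply: measurable_bounded_integrable => //.
- apply: (@le_lt_trans _ _ (p t y [set: R])).
    by apply: le_measure => //; rewrite inE.
  by rewrite prob_kernel ltry.
- exact: C0_halfline_measurable.
have [K _ HK] := C0_halfline_bounded f f0.
exists K; split; first exact: num_real.
move=> M KM z /=; rewrite in_itv/= andbT => z0.
exact: le_trans (HK _ z0) (ltW KM).
Qed.

Lemma semigroup_op_le t y f g e : 0 <= t -> 0 <= y ->
  C0_halfline f -> C0_halfline g ->
  (forall z, 0 <= z -> `|f z - g z| <= e) ->
  `|semigroup_op p t f y - semigroup_op p t g y| <= e.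
Proof.
move=> t0 y0 f0 g0 fg; have [mass _ _ _ _] := fp.
have If := C0_halfline_integrable t y f f0.
have Ig := C0_halfline_integrable t y g g0.
have e_int : (p t y).-integrable (`[0, +oo[%classic : set R) (EFin \o cst e).
  apply: measurable_bounded_integrable => //; first by rewrite mass// ltry.
  exists `|e|; split; first exact: num_real.
  by move=> M eM z _; exact: ltW.
rewrite /semigroup_op -RintegralB//.
have Ifg : (p t y).-integrable (`[0, +oo[%classic : set R) (EFin \o (fun z => f z - g z)).
  have := integrableB itv0_measurable If Ig.
  by apply: eq_integrable => // z _; rewrite /= EFinB.
apply: (le_trans (le_normr_Rintegral _ _)) => //.
apply: (@le_trans _ _ (\int[p t y]_(z in `[0, +oo[) cst e z)).
  apply: le_Rintegral => //.
  - exact: (integrable_norm Ifg).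
  - by move=> z; rewrite /= in_itv/= andbT; exact: fg.
by rewrite Rintegral_cst// mass//= mulr1.
Qed.

Lemma semigroup_op_lin t y f g h : 0 <= t -> 0 <= y ->
  C0_halfline f -> C0_halfline g ->
  semigroup_op p t (fun z => f z - h * g z) y =
  semigroup_op p t f y - h * semigroup_op p t g y.
Proof.
move=> t0 y0 f0 g0.
have If := C0_halfline_integrable t y f f0.
have Ig := C0_halfline_integrable t y g g0.
have Ihg : (p t y).-integrable (`[0, +oo[%classic : set R) (EFin \o (fun z => h * g z)).
  have := integrableZl itv0_measurable h Ig.
  by apply: eq_integrable => // z _; rewrite /= EFinM.
by rewrite /semigroup_op RintegralB// RintegralZl.
Qed.

Lemma C0_halfline_lin f g h : C0_halfline f -> C0_halfline g ->
  C0_halfline (fun z => f z - h * g z).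
Proof.
move=> [fc f0] [gc g0]; split.
  move=> z; apply: cvgB; first exact: fc.
  by apply: cvgMr; exact: gc.
rewrite -[0](subr0 0) -[X in _ --> _ - X](mulr0 h).
by apply: cvgB => //; exact: cvgMr.
Qed.

(** The half-line already carries the whole mass, so integrals over it and over
    the line agree. *)
Lemma transition_outside_eq0 t y : 0 <= t -> 0 <= y -> p t y (~` `[0, +oo[) = 0%E.
Proof.
move=> t0 y0; have [mass _ _ _ _] := fp.
pose H : set R := `[0, +oo[%classic.
have mH : measurable H by [].
have pH : p t y H = 1%E by exact: mass.
have : (p t y H + p t y (~` H) = 1)%E.
  rewrite -measureU//; [|exact: measurableC|by rewrite setICr].
  by rewrite setUv; exact: prob_kernel.
rewrite pH -/H.
case: (p t y (~` H)) => [r| |]//; rewrite -EFinD => -[] /eqP.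
by rewrite -subr_eq0 addrC addrA addNr add0r => /eqP ->.
Qed.

Lemma integral_halfline t y (f : R -> \bar R) : 0 <= t -> 0 <= y ->
  measurable_fun [set: R] f -> (forall z, 0 <= f z)%E ->
  (\int[p t y]_(z in `[0%R, +oo[) f z = \int[p t y]_z f z)%E.
Proof.
move=> t0 y0 mf f0.
rewrite -(setUv (`[0, +oo[%classic : set R)) ge0_integral_setU//.
- rewrite [X in (_ + X)%E](_ : _ = 0%E) ?adde0//.
  apply: null_set_integral; [exact: measurableC| |exact: transition_outside_eq0].
  exact: measurable_funTS.
- exact: measurableC.
- by rewrite setUv.
- exact/disj_setPCl.
Qed.

Lemma chapman_kolmogorov_integral s t y (f : R -> \bar R) :
  0 <= s -> 0 <= t -> 0 <= y ->
  measurable_fun [set: R] f -> (forall z, 0 <= f z)%E ->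
  (\int[p (s + t) y]_z f z =
   \int[p s y]_(z in `[0%R, +oo[) \int[p t z]_u f u)%E.
Proof.
move=> s0 t0 y0 mf f0; have [_ _ CK _ _] := fp.
apply: ge0_integral_mixture => //.
- by move=> U mU; apply: measurable_funTS; exact: measurable_kernel.
- by move=> U mU; exact: CK.
Qed.

Lemma semigroup_opD s t y f : 0 <= s -> 0 <= t -> 0 <= y ->
  measurable_fun [set: R] f ->
  C0_halfline f -> (forall z, 0 <= f z) ->
  semigroup_op p (s + t) f y = semigroup_op p s (semigroup_op p t f) y.
Proof.
move=> s0 t0 y0 mf f0 fge0.
rewrite /semigroup_op/= /Rintegral; congr fine.
have mEf : measurable_fun [set: R] (EFin \o f) by exact/measurable_EFinP.
rewrite integral_halfline// ?addr_ge0// chapman_kolmogorov_integral//.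
apply: eq_integral => z; rewrite inE/= in_itv/= andbT => z0.
rewrite -integral_halfline// fineK//.
by apply: integrable_fin_num => //; exact: C0_halfline_integrable.
Qed.

End semigroup.

(** * The semigroup acts on the Gaussian solutions by a time shift *)

Section constancy.
Context (R : realType).

(** Composing [f] with the projection of the line onto the segment gives a
    function on the line whose derivative is everywhere zero. *)
Lemma flat_on_segment_cst (f : R -> R) (t : R) : 0 <= t ->
  (forall s e : R, 0 <= s <= t -> 0 < e ->
    \forall s' \near s, 0 <= s' <= t -> `|f s' - f s| <= e * `|s' - s|) ->
  f 0 = f t.
Proof.
move=> t0 flat.
pose cl (x : R) := Num.max 0 (Num.min x t).
have cl_in x : 0 <= cl x <= t.
  by rewrite /cl le_max lexx/= ge_max t0 ge_min lexx orbT.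
have cl_lip x x' : `|cl x' - cl x| <= `|x' - x|.
  have mono u v : u <= v -> cl u <= cl v /\ cl v - cl u <= v - u.
    rewrite /cl => uv.
    by case: (leP u t) => ut; case: (leP v t) => vt; rewrite ?(max_r t0);
      try (case: (leP 0 u) => u0); try (case: (leP 0 v) => v0); split; lra.
  have [le|/ltW le] := leP x x'.
    by have [h1 h2] := mono _ _ le; rewrite !ger0_norm ?subr_ge0.
  have [h1 h2] := mono _ _ le.
  by rewrite (distrC (cl x')) (distrC x') !ger0_norm ?subr_ge0.
have der x : is_derive x (1:R) (f \o cl) 0.
  have lim0 : h^-1 *: ((f \o cl) (h *: (1:R) + x) - (f \o cl) x) @[h --> (0:R)^'] --> (0:R).
    apply/cvgr0Pnorm_le => e e0.
    have /nbhs_ballP[n /= n0 Hn] := flat (cl x) e (cl_in x) e0.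
    near=> h.
    have h0 : h != 0 by near: h; exact: nbhs_dnbhs_neq.
    rewrite normrZ normfV ler_pdivrMl ?normr_gt0// mulrC.
    have hx : `|cl (h *: (1:R) + x) - cl x| <= `|h|.
      by apply: le_trans (cl_lip _ _) _; rewrite addrK /GRing.scale/= mulr1.
    apply: (le_trans (Hn (cl (h *: (1:R) + x)) _ (cl_in _))).
      rewrite /ball/= distrC; apply: le_lt_trans hx _.
      by near: h; apply: dnbhs0_lt.
    by rewrite ler_wpM2l// ltW.
  apply: DeriveDef; first by apply/cvg_ex; exists 0.
  exact: cvg_lim lim0.
have := @is_derive_0_is_cst R (f \o cl) 0 t der.
by rewrite /= /cl (min_l t0) minxx maxxx (max_r t0).
Unshelve. all: by end_near. Qed.

End constancy.

Section heat_semigroup.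
Context (R : realType) (p : R -> R.-pker R ~> R) (c : R).
Hypothesis c01 : 0 < c <= 1.
Hypothesis bp : bessel_transition_function (2 * c) p.
Implicit Types (s t y z h e m : R).

Let fp : feller_transition_function p. Proof. by case: bp. Qed.

Let c01' : 0 <= c <= 1. Proof. by case/andP: c01 => /ltW -> ->. Qed.

Lemma generator_bheat m e : 0 < m -> 0 < e ->
  \forall h \near 0^'+, forall z, 0 <= z ->
    `|semigroup_op p h (bheat c m) z - bheat c m z - h * dt_bheat c m z| <= e * h.
Proof.
move=> m0 e0; have [_ /(_ (bheat c m) (dt_bheat c m))[_ gen]] := bp.
have [_ _ /(_ e e0) lim] := gen (reflecting_bessel_bheat R c m c01 m0).
near=> h => z z0.
have h0 : 0 < h by near: h; exact: nbhs_right_gt.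
have := near lim h _ => /(_ _)/wrap[//|/(_ z z0)].
rewrite -(ler_pM2r h0) -[X in _ * X <= _ -> _](gtr0_norm h0) -normrM.
by rewrite mulrBl divfK ?gt_eqF// (mulrC (dt_bheat _ _ _)).
Unshelve. all: by end_near. Qed.

Lemma bheat_taylor_near m e : 0 < m -> 0 < e ->
  \forall h \near 0^'+, (forall z, `|bheat c (m + h) z - bheat c m z - h * dt_bheat c m z| <= e * h)
   /\ (forall z, `|bheat c (m - h) z - bheat c m z + h * dt_bheat c m z| <= e * h).
Proof.
move=> m0 e0; have [K HK] := bheat_taylor R c m c01' m0.
have eK : 0 < e / (`|K| + 1) by rewrite divr_gt0// ltr_wpDl.
near=> h.
have h0 : 0 < h by near: h; exact: nbhs_right_gt.
have hm : h <= m / 2 by near: h; apply: nbhs_right_le; rewrite divr_gt0.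
have hK : K * h ^+ 2 <= e * h.
  have : h <= e / (`|K| + 1) by near: h; exact: nbhs_right_le.
  rewrite ler_pdivlMr ?ltr_wpDl// expr2 mulrA ler_pM2r// => hK.
  apply: le_trans hK; rewrite mulrC ler_pM2l//.
  by rewrite (le_trans (ler_norm _))// lerDl.
split=> z.
  by apply: le_trans hK; apply: HK; rewrite gtr0_norm.
have := HK (- h) z; rewrite normrN gtr0_norm// => /(_ hm).
by rewrite mulNr opprK sqrrN => /le_trans; apply.
Unshelve. all: by end_near. Qed.

(** With [m = M - s], [semigroup_forward] controls the left increments at [s]
    of [s |-> P_s (bheat c (M - s))], and [semigroup_backward] the right ones. *)
Lemma semigroup_forward m e : 0 < m -> 0 < e ->
  \forall h \near 0^'+, forall z, 0 <= z ->
    `|semigroup_op p h (bheat c m) z - bheat c (m + h) z| <= e * h.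
Proof.
move=> m0 e0; have e2 : 0 < e / 2 by lra.
apply: filterS2 (generator_bheat m _ m0 e2) (bheat_taylor_near m _ m0 e2) => h H1 [H2 _] z z0.
have := H1 z z0; have := H2 z.
by rewrite !ler_norml => /andP[? ?] /andP[? ?]; apply/andP; split; lra.
Qed.

(** Here the function to which the semigroup is applied moves with [h]: it is
    first replaced by its Taylor polynomial in [h], at a cost that contraction
    keeps small, and strong continuity handles the linear term. *)
Lemma semigroup_backward m e : 0 < m -> 0 < e ->
  \forall h \near 0^'+, forall z, 0 <= z ->
    `|semigroup_op p h (bheat c (m - h)) z - bheat c m z| <= e * h.
Proof.
move=> m0 e0; have e3 : 0 < e / 3 by lra.
have [_ _ _ _ /(_ _ (dt_bheat_C0 R c m c01' m0) _ e3) sc] := fp.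
have H3 := generator_bheat m _ m0 e3.
have H4 := bheat_taylor_near m _ m0 e3.
near=> h => z z0.
have h0 : 0 < h by near: h; exact: nbhs_right_gt.
have hm : h < m by near: h; exact: nbhs_right_lt.
have q0 := bheat_C0 R c m m0.
have d0 := dt_bheat_C0 R c m c01' m0.
have qh : C0_halfline (bheat c (m - h)) by apply: bheat_C0; rewrite subr_gt0.
have A1 : `|semigroup_op p h (bheat c (m - h)) z
            - semigroup_op p h (fun z => bheat c m z - h * dt_bheat c m z) z| <= e / 3 * h.
  apply: semigroup_op_le => //; first exact: C0_halfline_lin.
  move=> w w0; rewrite opprB addrA addrAC.
  by have := near H4 h _ => /(_ _)/wrap[//|[_ /(_ w)]].
move: A1; rewrite semigroup_op_lin ?(ltW h0)//.
have := near H3 h _ => /(_ _)/wrap[//|/(_ z z0)].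
have := near sc h _ => /(_ _)/wrap[//|/(_ z z0)].
rewrite -(ler_pM2r h0) -[X in _ * X <= _ -> _](gtr0_norm h0) -normrM.
rewrite !ler_norml => /andP[? ?] /andP[? ?] /andP[? ?]; apply/andP; split; lra.
Unshelve. all: by end_near. Qed.

(** The heat equation makes [s |-> P_s (bheat c (m + t - s)) y] flat on [[0, t]];
    its end values are the two sides. *)
Lemma semigroup_bheat m t y : 0 < m -> 0 <= t -> 0 <= y ->
  semigroup_op p t (bheat c m) y = bheat c (m + t) y.
Proof.
move=> m0 t0 y0.
pose phi s := semigroup_op p s (bheat c (m + t - s)) y.
have qm u : 0 < u -> measurable_fun [set: R] (bheat c u).
  by move=> u0; apply: continuous_measurable_fun; exact: bheat_continuous.
have step a b e : 0 <= a -> a <= b -> b <= t ->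
    (forall z, 0 <= z -> `|semigroup_op p (b - a) (bheat c (m + t - b)) z -
                         bheat c (m + t - a) z| <= e) ->
    `|phi b - phi a| <= e.
  move=> a0 ab bt H.
  have bq : C0_halfline (bheat c (m + t - b)) by apply: bheat_C0; lra.
  have aq : C0_halfline (bheat c (m + t - a)) by apply: bheat_C0; lra.
  have ba : 0 <= b - a by rewrite subr_ge0.
  have [_ _ _ C0S _] := fp.
  have pb : phi b =
      semigroup_op p a (semigroup_op p (b - a) (bheat c (m + t - b))) y.
    rewrite -semigroup_opD ?(addrC a) ?subrK//; first by apply: qm; lra.
    by move=> z; exact: expR_ge0.
  by rewrite pb; apply: semigroup_op_le => //; exact: C0S.
have flat s e : 0 <= s <= t -> 0 < e ->
    \forall s' \near s, 0 <= s' <= t -> `|phi s' - phi s| <= e * `|s' - s|.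
  move=> /andP[s0 st] e0; have ms : 0 < m + t - s by lra.
  have /nbhs_ballP[n1 /= n10 H1] := semigroup_forward _ _ ms e0.
  have /nbhs_ballP[n2 /= n20 H2] := semigroup_backward _ _ ms e0.
  apply/nbhs_ballP; exists (Num.min n1 n2); first by rewrite /= lt_min n10.
  move=> s'; rewrite /ball/= lt_min => /andP[b1 b2] /andP[s'0 s't].
  have [s's|ss'|->] := ltgtP s' s; last by rewrite !subrr normr0 mulr0.
  - have ss0 : 0 < s - s' by rewrite subr_gt0.
    rewrite distrC [X in _ * X]distrC (gtr0_norm ss0).
    apply: step => //; [exact: ltW|move=> z z0].
    have -> : m + t - s' = m + t - s + (s - s') by ring.
    by apply: H1 => //; rewrite /ball/= sub0r normrN.
  - have ss0 : 0 < s' - s by rewrite subr_gt0.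
    rewrite (gtr0_norm ss0).
    apply: step => //; [exact: ltW|move=> z z0].
    have -> : m + t - s' = m + t - s - (s' - s) by ring.
    by apply: H2 => //; rewrite /ball/= sub0r normrN distrC.
have := flat_on_segment_cst R phi t t0 flat.
rewrite /phi subr0 addrK => <-.
have [_ p0 _ _ _] := fp.
rewrite /semigroup_op /Rintegral.
rewrite (eq_measure_integral \d_y); last first.
  by move=> A mA _; exact: p0.
rewrite integral_dirac//.
  by rewrite diracE mem_set ?mul1e//= in_itv/= y0.
by apply: measurable_funTS; apply/measurable_EFinP; apply: qm; lra.
Qed.

End heat_semigroup.

(** * Mixing over a beta-distributed mass *)

Section prelim.
Context (R : realType).
Local Notation leb := (@lebesgue_measure R).

Lemma measurable_invr : measurable_fun [set: R] (@GRing.inv R).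
Proof.
rewrite -(setvU [set (0:R)]); apply/measurable_funU => //.
  exact: measurableC.
split; last exact: measurable_fun_set1.
apply: open_continuous_measurable_fun.
  by apply: closed_openC; exact: closed_eq.
by move=> x; rewrite inE/= => /eqP x0; exact: inv_continuous.
Qed.

(** Both sides integrate against measures that agree on intervals. *)
Lemma ge0_integral_affine (k e : R) (g : R -> \bar R) : 0 < k ->
  measurable_fun [set: R] g -> (forall x, 0 <= g x)%E ->
  (\int[leb]_x g x = k%:E * \int[leb]_x g (k * x + e)%R)%E.
Proof.
move=> k0 mg g0.
pose phi (x : R) := k * x + e.
have mphi : measurable_fun [set: R] phi.
  by apply: measurable_funD => //; exact: measurable_funM.
have @nu : {measure set (measurableTypeR R) -> \bar R}.
  by refine (mscale (NngNum (ltW k0)) (pushforward leb (phi : _ -> measurableTypeR R))).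
have nuE A : measurable A -> leb A = nu A.
  apply: lebesgue_measure_unique => //= _ [[a b]] _ <-.
  rewrite /nu /mscale/= /pushforward.
  have -> : phi @^-1` `]a, b]%classic = `](a - e) / k, (b - e) / k]%classic.
    apply/seteqP; split => x /=; rewrite !in_itv/= /phi => /andP[].
      by move=> ax xb; rewrite ltr_pdivrMr// ler_pdivlMr//; apply/andP; split; lra.
    by rewrite ltr_pdivrMr// ler_pdivlMr// => ax xb; apply/andP; split; lra.
  rewrite !lebesgue_measure_itv/= !lte_fin ltr_pM2r ?invr_gt0// ltrD2r.
  case: ifPn => ab; last by rewrite mule0.
  by rewrite -!EFinB -EFinM; congr EFin; field; rewrite gt_eqF.
rewrite (eq_measure_integral nu); last by move=> A mA _; exact: nuE.
rewrite ge0_integral_mscale//= ge0_integral_pushforward//.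
Qed.

End prelim.

Section kernel_probability.
Context (R : realType) (k : R.-pker R ~> R) (x : R).

(** [k x] with the probability structure that Tonelli's theorem needs. *)
Definition ker_at : set R -> \bar R := k x.
HB.instance Definition _ := Measure.on ker_at.
HB.instance Definition _ := Measure_isProbability.Build _ _ _ ker_at (prob_kernel x).

End kernel_probability.

Arguments ker_at {R}.

Section gaussian_mixture.
Context (R : realType).
Local Notation leb := (@lebesgue_measure R).
Implicit Types (f : R -> R) (r h y b : R).

(** When [f] is the density of [A], this is the mean of
    [exp (- y^2 / (2 r A))]. *)
Definition gmix f r y : \bar R :=
  (\int[leb]_b (f b * expR (- (y ^+ 2 / (2 * (r * b)))))%:E)%E.

(** What is left of [gmix f (r + h) y] once a process started at [y] has run
    for a time [h]; see [semigroup_gmix]. *)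
Definition gmix_tail f h r y : \bar R :=
  (\int[leb]_(b in `](h / (r + h))%R, +oo[)
     (f b * expR (- (y ^+ 2 / (2 * ((r + h) * b)))))%:E)%E.

Lemma measurable_gauss r : measurable_fun [set: R * R]
  (fun zb : R * R => expR (- (zb.1 ^+ 2 / (2 * (r * zb.2))))).
Proof.
apply: measurableT_comp => //; apply: measurableT_comp => //.
apply: measurable_funM; first exact: measurable_funX.
apply: (@measurableT_comp _ _ _ _ _ _ (@GRing.inv R)).
  exact: measurable_invr.
by apply: measurable_funM => //; exact: measurable_funM.
Qed.

Lemma measurable_gauss_mass r y : measurable_fun [set: R]
  (fun b : R => expR (- (y ^+ 2 / (2 * (r * b))))).
Proof.
apply: (measurableT_comp (measurable_gauss r) (_ : measurable_fun _ (fun b => (y, b)))).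
exact: measurable_fun_pair.
Qed.

Lemma measurable_gauss_space r b : measurable_fun [set: R]
  (fun y : R => expR (- (y ^+ 2 / (2 * (r * b))))).
Proof.
apply: (measurableT_comp (measurable_gauss r) (_ : measurable_fun _ (fun y => (y, b)))).
exact: measurable_fun_pair.
Qed.

End gaussian_mixture.

Arguments gmix {R}.
Arguments gmix_tail {R}.

Section beta_mixture.
Context (R : realType) (c : R).
Hypothesis c01 : 0 < c < 1.
Local Notation leb := (@lebesgue_measure R).
Local Notation f := (beta_one_minus_pdf (1 - c)).
Implicit Types (r h y b : R).

Lemma Gamma_fun_ge0 (a : R) : 0 <= Gamma_fun a.
Proof. by apply: Rintegral_ge0 => u _; rewrite mulr_ge0 ?powR_ge0 ?expR_ge0. Qed.

Lemma beta_pdf_ge0 b : 0 <= f b.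
Proof.
by rewrite /beta_one_minus_pdf !mulr_ge0 ?powR_ge0// invr_ge0 mulr_ge0 ?Gamma_fun_ge0.
Qed.

Lemma measurable_beta_pdf : measurable_fun [set: R] f.
Proof.
apply: measurable_funM => //; apply: measurable_funM => //.
apply: measurable_funM; first exact: measurable_powR.
apply: (measurableT_comp (measurable_powR _)).
exact: measurable_funB.
Qed.

Lemma beta_pdf_eq0 b : ~~ (0 < b < 1) -> f b = 0.
Proof.
by move=> b01; rewrite /beta_one_minus_pdf indicE memNset ?mulr0//= in_itv/=; exact/negP.
Qed.

(** Why the exponents of the density are what they are: an affine map fixing
    [1] multiplies [1 - b] by a constant, so the power of [1 - b] only
    contributes a constant, and the power of [b] produces exactly the factor
    by which the semigroup rescales [exp (- y^2 / (2 r b))]. *)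
Lemma beta_pdf_affine r h b : 0 < r -> 0 <= h -> 0 < b < 1 ->
  f (r / (r + h) * b + h / (r + h)) * (r / (r + h)) =
  f b * expR (c * ln (r * b)) * expR (- (c * ln (r * b + h))).
Proof.
move=> r0 h0 /andP[b0 b1].
have rh : 0 < r + h by lra.
have rbh : 0 < r * b + h by rewrite ltr_pwDl// mulr_gt0.
have -> : r / (r + h) * b + h / (r + h) = (r * b + h) / (r + h).
  by field; rewrite gt_eqF.
have p0 : 0 < (r * b + h) / (r + h) by rewrite divr_gt0.
have p1E : 1 - (r * b + h) / (r + h) = r / (r + h) * (1 - b).
  by field; rewrite gt_eqF.
have k0 : 0 < r / (r + h) by rewrite divr_gt0.
have b1' : 0 < 1 - b by rewrite subr_gt0.
have p1 : 0 < 1 - (r * b + h) / (r + h) by rewrite p1E mulr_gt0.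
rewrite /beta_one_minus_pdf !indicE !mem_set/= ?in_itv/= ?b0 ?p0 ?b1//; last first.
  by rewrite -subr_gt0.
rewrite !mulr1 /powR !gt_eqF//.
rewrite -[X in _ * X = _](lnK k0) ?posrE// p1E.
rewrite (lnM k0 b1') (ln_div rbh rh) (ln_div r0 rh) (lnM r0 b0).
set C := (Gamma_fun _ * _)^-1.
have expE u1 u2 u3 v1 v2 v3 v4 : u1 + u2 + u3 = v1 + v2 + v3 + v4 ->
    expR u1 * expR u2 * C * expR u3 =
    expR v1 * expR v2 * C * expR v3 * expR v4 :> R.
  move=> uv; transitivity (expR (u1 + u2 + u3) * C); first by rewrite !expRD; ring.
  by rewrite uv !expRD; ring.
by apply: expE; ring.
Qed.

(** [semigroup_bheat] under the integral sign, then the substitution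
    [b' = (r b + h) / (r + h)], which maps ]0, 1[ onto ]h / (r + h), 1[. *)
Lemma semigroup_gmix (p : R -> R.-pker R ~> R) r h y :
  bessel_transition_function (2 * c) p -> 0 < r -> 0 <= h -> 0 <= y ->
  (\int[p h y]_z gmix f r z = gmix_tail f h r y)%E.
Proof.
move=> bp r0 h0 y0; have [fp _] := bp.
have rh : 0 < r + h by lra.
have k0 : 0 < r / (r + h) by rewrite divr_gt0.
have c01' : 0 < c <= 1 by case/andP: c01 => -> /ltW ->.
have F0 : (forall zb : R * R,
    0 <= (f zb.2 * expR (- (zb.1 ^+ 2 / (2 * (r * zb.2)))))%:E)%E.
  by move=> zb; rewrite lee_fin mulr_ge0 ?beta_pdf_ge0 ?expR_ge0.
have mF : measurable_fun [set: R * R]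
    (fun zb => (f zb.2 * expR (- (zb.1 ^+ 2 / (2 * (r * zb.2)))))%:E).
  apply/measurable_EFinP; apply: measurable_funM; last exact: measurable_gauss.
  exact: (measurableT_comp measurable_beta_pdf).
have -> : (\int[p h y]_z gmix f r z =
    \int[leb]_b \int[p h y]_z (f b * expR (- (z ^+ 2 / (2 * (r * b)))))%:E)%E.
  exact: (@fubini_tonelli _ _ _ _ _ (ker_at (p h) y) leb _ mF F0).
pose G b : \bar R := (f b * expR (- (y ^+ 2 / (2 * ((r + h) * b))))
                      * \1_(`]h / (r + h), +oo[ : set R) b)%:E.
have G0 b : (0 <= G b)%E 
  by rewrite lee_fin mulr_ge0// mulr_ge0 ?beta_pdf_ge0 ?expR_ge0.
have mG : measurable_fun [set: R] G.
  apply/measurable_EFinP; apply: measurable_funM => //.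
  by apply: measurable_funM; [exact: measurable_beta_pdf|exact: measurable_gauss_mass].
transitivity (\int[leb]_b G b)%E; last first.
  rewrite /gmix_tail [RHS]integral_mkcond; apply: eq_integral => b _.
  rewrite patchE /G indicE; case: ifPn => _; first by rewrite mulr1.
  by rewrite mulr0.
rewrite [RHS](ge0_integral_affine _ (r / (r + h)) (h / (r + h)))//.
rewrite -[RHS]ge0_integralZl//; last 2 first.
- apply: (measurableT_comp mG).
  by apply: measurable_funD => //; exact: measurable_funM.
- by rewrite lee_fin ltW.
apply: eq_integral => b _.
have [b01|b01] := boolP (0 < b < 1); last first.
  under eq_integral do rewrite (beta_pdf_eq0 _ b01) mul0r.
  rewrite integral0 /G.
  have kb : r / (r + h) * b + h / (r + h) = 1 - r / (r + h) * (1 - b).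
    by field; rewrite gt_eqF.
  have [b1|b1] := leP 1 b.
    have k1 : 1 <= r / (r + h) * b + h / (r + h).
      by rewrite kb lerBrDr gerDl pmulr_rle0// subr_le0.
    by rewrite beta_pdf_eq0 ?mul0r ?mule0// negb_and -!leNgt k1 orbT.
  have b0 : b <= 0 by rewrite leNgt; apply: contra b01 => ->.
  rewrite indicE memNset ?mulr0 ?mule0//= in_itv/= andbT; apply/negP.
  by rewrite -leNgt gerDr pmulr_rle0.
have /andP[b0 b1] := b01.
have rb : 0 < r * b by rewrite mulr_gt0.
under eq_integral do rewrite EFinM.
rewrite ge0_integralZl//; last 2 first.
- by apply/measurable_EFinP; exact: measurable_gauss_space.
- by rewrite lee_fin beta_pdf_ge0.
have gaussE z : expR (- (z ^+ 2 / (2 * (r * b)))) =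
    expR (c * ln (r * b)) * bheat c (r * b) z.
  by rewrite bheatE [RHS]mulrA -expRD addrN expR0 mul1r.
have intE : (\int[p h y]_z (expR (- (z ^+ 2 / (2 * (r * b)))))%:E =
    (expR (c * ln (r * b)) * bheat c (r * b + h) y)%:E)%E.
  rewrite -(semigroup_bheat R p c c01' bp)// /semigroup_op.
  under eq_integral do rewrite gaussE EFinM.
  have qm : measurable_fun [set: R] (EFin \o bheat c (r * b)).
    by apply/measurable_EFinP; apply: continuous_measurable_fun; exact: bheat_continuous.
  have q0 z : (0 <= (bheat c (r * b) z)%:E)%E by rewrite lee_fin expR_ge0.
  rewrite ge0_integralZl//.
  rewrite -(integral_halfline R p fp)// EFinM /Rintegral fineK//.
  apply: integrable_fin_num => //.
  by apply: C0_halfline_integrable => //; exact: bheat_C0.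
rewrite intE /G -!EFinM; congr EFin.
rewrite indicE mem_set/=; last by rewrite in_itv/= andbT ltrDr mulr_gt0.
have -> : (r + h) * (r / (r + h) * b + h / (r + h)) = r * b + h.
  by field; rewrite gt_eqF.
rewrite mulr1 [RHS]mulrA [in RHS](mulrC (r / (r + h))) beta_pdf_affine//.
by rewrite bheatE !mulrA.
Qed.
End beta_mixture.

Section gmix_bounds.
Context (R : realType) (f : R -> R).
Hypothesis mf : measurable_fun [set: R] f.
Hypothesis f0 : forall b, 0 <= f b.
Hypothesis f_out : forall b, ~~ (0 < b < 1) -> f b = 0.
Hypothesis f_total : (\int[@lebesgue_measure R]_b (f b)%:E = 1)%E.
Local Notation leb := (@lebesgue_measure R).
Implicit Types (r h y b e : R).

Let term r y b : \bar R := (f b * expR (- (y ^+ 2 / (2 * (r * b)))))%:E.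

Let term_ge0 r y b : (0 <= term r y b)%E.
Proof. by rewrite lee_fin mulr_ge0 ?f0 ?expR_ge0. Qed.

Let measurable_term r y : measurable_fun [set: R] (term r y).
Proof.
by apply/measurable_EFinP/measurable_funM => //; exact: measurable_gauss_mass.
Qed.

Lemma gmix_ge0 r y : (0 <= gmix f r y)%E.
Proof. by apply: integral_ge0 => b _; exact: term_ge0. Qed.

Lemma measurable_gmix r : measurable_fun [set: R] (gmix f r).
Proof.
apply: (@measurable_fun_fubini_tonelli_F _ _ _ _ _ leb
  (fun yb : R * R => (f yb.2 * expR (- (yb.1 ^+ 2 / (2 * (r * yb.2)))))%:E)).
  apply/measurable_EFinP; apply: measurable_funM; last exact: measurable_gauss.
  exact: (measurableT_comp mf).
by move=> yb; rewrite lee_fin mulr_ge0 ?f0 ?expR_ge0.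
Qed.

Lemma gmix_tail_ge0 h r y : (0 <= gmix_tail f h r y)%E.
Proof. by apply: integral_ge0 => b _; exact: term_ge0. Qed.

Lemma measurable_gmix_tail h r : measurable_fun [set: R] (gmix_tail f h r).
Proof.
pose D : set R := `]h / (r + h), +oo[%classic.
have -> : gmix_tail f h r = (fun y => \int[leb]_b
    (f b * \1_D b * expR (- (y ^+ 2 / (2 * ((r + h) * b)))))%:E)%E.
  apply/funext => y; rewrite /gmix_tail integral_mkcond.
  apply: eq_integral => b _; rewrite patchE indicE.
  by case: ifPn => _; rewrite ?mulr1// mulr0 mul0r.
apply: (@measurable_fun_fubini_tonelli_F _ _ _ _ _ leb (fun yb : R * R =>
  (f yb.2 * \1_D yb.2 * expR (- (yb.1 ^+ 2 / (2 * ((r + h) * yb.2)))))%:E)).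
  apply/measurable_EFinP; apply: measurable_funM; last exact: measurable_gauss.
  apply: (measurableT_comp (_ : measurable_fun _ (fun b => f b * \1_D b))) => //.
  by apply: measurable_funM => //; apply: measurable_indic; exact: measurable_itv.
by move=> yb; rewrite lee_fin mulr_ge0 ?expR_ge0// mulr_ge0.
Qed.

Lemma gmix_le r y K : 0 <= K ->
  (forall b, 0 < b < 1 -> expR (- (y ^+ 2 / (2 * (r * b)))) <= K) ->
  (gmix f r y <= K%:E)%E.
Proof.
move=> K0 HK; apply: (@le_trans _ _ (\int[leb]_b (K%:E * (f b)%:E))%E).
  apply: ge0_le_integral => //.
  - by move=> b _; exact: term_ge0.
  - exact: measurable_term.
  - by apply: measurable_funeM; exact/measurable_EFinP.
  - move=> b _; rewrite -EFinM lee_fin mulrC.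
    have [b01|b01] := boolP (0 < b < 1); last by rewrite f_out// !mulr0.
    by rewrite ler_wpM2r ?f0// HK.
rewrite ge0_integralZl ?f_total ?mule1//.
  exact/measurable_EFinP.
by move=> b _; rewrite lee_fin f0.
Qed.

Lemma gmix_le1 r y : 0 < r -> (gmix f r y <= 1)%E.
Proof.
move=> r0; apply: gmix_le => // b /andP[b0 _].
by rewrite -expR0 ler_expR oppr_le0 divr_ge0 ?sqr_ge0// !mulr_ge0// ltW.
Qed.

(** Far from [0] compared with the remaining time, a zero is very unlikely. *)
Lemma gmix_far h e y : 0 < h -> 0 <= e <= y ->
  (gmix f h y <= (expR (- (e ^+ 2 / (2 * h))))%:E)%E.
Proof.
move=> h0 /andP[e0 ey]; apply: gmix_le => [|b /andP[b0 b1]]; first exact: expR_ge0.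
rewrite ler_expR lerN2 ler_pM ?sqr_ge0 ?invr_ge0 ?mulr_ge0 ?(ltW h0)//.
  by rewrite lerXn2r// nnegrE (le_trans e0).
rewrite lef_pV2 ?posrE ?mulr_gt0// ler_pM2l// ger_pMr//.
exact: ltW.
Qed.

Lemma gmix_tail_le h r y : (gmix_tail f h r y <= gmix f (r + h) y)%E.
Proof.
apply: ge0_subset_integral => //.
  exact: measurable_term.
by move=> b _; exact: term_ge0.
Qed.

(** On the discarded range [(r + h) * b <= h], so the Gaussian factor is at most
    [exp (- e^2 / (2 h))]. *)
Lemma gmix_le_tail h r e y : 0 < h -> 0 < r -> 0 <= e <= y ->
  (gmix f (r + h) y <=
   gmix_tail f h r y + (expR (- (e ^+ 2 / (2 * h))))%:E)%E.
Proof.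
move=> h0 r0 /andP[e0 ey]; have rh : 0 < r + h by lra.
set D : set R := `]h / (r + h), +oo[%classic.
have mD : measurable D by exact: measurable_itv.
rewrite /gmix -(setUv D) ge0_integral_setU//; last 4 first.
- exact: measurableC.
- by rewrite setUv; exact: measurable_term.
- by move=> b _; exact: term_ge0.
- exact/disj_setPCl.
rewrite leeD2l//.
pose K := expR (- (e ^+ 2 / (2 * h))).
apply: (@le_trans _ _ (\int[leb]_(b in ~` D) (K%:E * (f b)%:E))%E).
  apply: ge0_le_integral => //.
  - exact: measurableC.
  - by move=> b _; exact: term_ge0.
  - by apply: measurable_funTS; exact: measurable_term.
  - by apply: measurable_funTS; apply: measurable_funeM; exact/measurable_EFinP.
  - move=> b; rewrite /D/= in_itv/= andbT => /negP; rewrite -leNgt => bh.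
    rewrite -EFinM lee_fin mulrC.
    have [/andP[b0 b1]|b01] := boolP (0 < b < 1); last by rewrite f_out// !mulr0.
    rewrite ler_wpM2r ?f0// /K ler_expR lerN2 ler_pM//.
    + exact: sqr_ge0.
    + by rewrite invr_ge0 mulr_ge0// ltW.
    + by rewrite lerXn2r// nnegrE (le_trans e0).
    + rewrite lef_pV2 ?posrE ?mulr_gt0// ler_pM2l// mulrC.
      by rewrite -ler_pdivlMr.
apply: (@le_trans _ _ (\int[leb]_b (K%:E * (f b)%:E))%E).
  apply: ge0_subset_integral => //; first exact: measurableC.
    by apply: measurable_funeM; exact/measurable_EFinP.
  by move=> b _; rewrite -EFinM lee_fin mulr_ge0 ?expR_ge0 ?f0.
rewrite ge0_integralZl ?f_total ?mule1//.
- exact/measurable_EFinP.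
- by move=> b _; rewrite lee_fin f0.
- by rewrite lee_fin expR_ge0.
Qed.

Lemma gmix_anti eta r e y : 0 < eta <= r -> 0 <= y <= e ->
  (gmix f eta e <= gmix f r y)%E.
Proof.
move=> /andP[eta0 etar] /andP[y0 ye].
apply: ge0_le_integral => //.
- by move=> b _; exact: term_ge0.
- exact: measurable_term.
- exact: measurable_term.
- move=> b _; rewrite lee_fin.
  have [/andP[b0 b1]|b01] := boolP (0 < b < 1); last by rewrite f_out// !mul0r.
  have r0 : 0 < r by lra.
  rewrite ler_wpM2l ?f0// ler_expR lerN2 ler_pM ?sqr_ge0//.
  + by rewrite invr_ge0 !mulr_ge0// ltW.
  + by rewrite lerXn2r// nnegrE// (le_trans y0).
  + by rewrite lef_pV2 ?posrE ?mulr_gt0// ler_pM2l// ler_pM2r.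
Qed.

Lemma gmix_near0 eta kappa : 0 < eta -> kappa < 1 ->
  exists2 e, 0 < e & (kappa%:E <= gmix f eta e)%E.
Proof.
move=> eta0 k1.
have cv : gmix f eta n.+1%:R^-1 @[n --> \oo] --> 1%E.
  rewrite -f_total.
  have -> : (\int[leb]_b (f b)%:E =
      \int[leb]_b lim (term eta n.+1%:R^-1 b @[n --> \oo]))%E.
    apply: eq_integral => b _; apply/esym/cvg_lim => //.
    apply/fine_cvgP; split; first by apply: nearW.
    have harm0 : n.+1%:R^-1 @[n --> \oo] --> (0 : R) by exact: cvg_harmonic.
    have sq0 : n.+1%:R^-1 ^+ 2 / (2 * (eta * b)) @[n --> \oo] --> (0 : R).
      rewrite -(mul0r (2 * (eta * b))^-1); apply: cvgMl.
      have -> : (fun n => n.+1%:R^-1 ^+ 2) = (fun n => n.+1%:R^-1 * n.+1%:R^-1 : R).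
        by apply/funext => n; rewrite expr2.
      have h := cvgM harm0 harm0; rewrite mulr0 in h; exact: h.
    have exp1 : expR (- (n.+1%:R^-1 ^+ 2 / (2 * (eta * b)))) @[n --> \oo] --> (1 : R).
      have h : - (n.+1%:R^-1 ^+ 2 / (2 * (eta * b))) @[n --> \oo] --> (- 0 : R).
        exact: cvgN sq0.
      rewrite oppr0 in h.
      have h' : expR (- (n.+1%:R^-1 ^+ 2 / (2 * (eta * b)))) @[n --> \oo] -->
          expR (0 : R).
        by apply: continuous_cvg; [exact: continuous_expR|exact: h].
      by rewrite expR0 in h'.
    rewrite -(mulr1 (f b)); exact: cvgMr exp1.
  apply: cvg_monotone_convergence => //.
  - by move=> n; exact: measurable_term.
  - by move=> n b _; exact: term_ge0.
  - move=> b _ m n mn; rewrite lee_fin.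
    have [/andP[b0 b1]|b01] := boolP (0 < b < 1); last by rewrite f_out// !mul0r.
    rewrite ler_wpM2l ?f0// ler_expR lerN2 ler_wpM2r//.
      by rewrite invr_ge0 !mulr_ge0// ltW.
    by rewrite lerXn2r ?nnegrE ?invr_ge0// lef_pV2 ?posrE// ler_nat.
have [[n kn]|no] := pselect (exists n, kappa%:E <= gmix f eta n.+1%:R^-1)%E.
  by exists n.+1%:R^-1; rewrite ?invr_gt0.
suff : (1 <= kappa%:E)%E by rewrite lee_fin leNgt k1.
rewrite -(cvg_lim _ cv)//; apply: lime_le; first by apply/cvg_ex; exists 1%E.
apply: nearW => n; rewrite leNgt; apply/negP => kn.
by apply: no; exists n; exact: ltW.
Qed.

End gmix_bounds.

(** * Almost-martingales along a grid *)

Section markov.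
Context (R : realType) d (T : measurableType d) (P : probability T R)
  (p : R -> R.-pker R ~> R) (X : R -> {RV P >-> R}).
Hypothesis mkv : markov_process p X.
Implicit Types (s t h e : R).

Lemma natural_filtration_measurable s (F : set T) :
  natural_filtration X s F -> measurable F.
Proof.
move: F; apply: smallest_sub; first exact: sigma_algebra_measurable.
move=> _ [r [B [_ _ mB ->]]].
by rewrite -[X in measurable X]setTI; exact: (measurable_funP (X r)).
Qed.

Lemma markov_integral s t (F : set T) (g : R -> \bar R) :
  0 <= s -> 0 <= t -> natural_filtration X s F ->
  measurable_fun [set: R] g -> (forall y, 0 <= g y)%E ->
  (\int[P]_(w in F) g (X (s + t) w) =
   \int[P]_(w in F) \int[p t (X s w)]_z g z)%E.
Proof.
move=> s0 t0 nF mg g0.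
have mF := natural_filtration_measurable _ _ nF.
have mX r U : measurable U -> measurable (X r @^-1` U).
  by move=> mU; rewrite -[X in measurable X]setTI; exact: (measurable_funP (X r)).
have @mu : {measure set R -> \bar R}.
  by refine (pushforward (mrestr P mF) (X (s + t))).
have muE U : mu U = P (F `&` X (s + t) @^-1` U).
  by rewrite /mu/= /pushforward /mrestr setIC.
transitivity (\int[mu]_y g y)%E.
  rewrite (@ge0_integral_mixture _ _ _ _ _ mu P F (fun w => dirac (X (s + t) w)))//.
  - by apply: eq_integral => w _; rewrite integral_dirac// diracT mul1e.
  - move=> U mU; apply: measurable_funTS.
    rewrite [Y in measurable_fun _ Y](_ : _ = EFin \o \1_(X (s + t) @^-1` U)).
      by apply/measurable_EFinP; apply: measurable_indic; exact: mX.
    by apply/funext => w; rewrite /= diracE indicE.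
  - move=> U mU; rewrite muE.
    rewrite (eq_integral (fun w => (\1_(X (s + t) @^-1` U) w)%:E)).
      by rewrite integral_indic// 1?setIC//; exact: mX.
    by move=> w _; rewrite /= diracE indicE.
apply: ge0_integral_mixture => //.
- move=> U mU; apply: measurable_funTS.
  apply: (measurableT_comp (measurable_kernel (p t) U mU)).
  exact: measurable_funPT.
- by move=> U mU; rewrite muE; exact: mkv.
Qed.

End markov.

Lemma lee_chain (R : realType) (pA pB I1 I2 a1 kK K : \bar R) :
  (I1 <= pB -> I2 <= a1 + K ->
   pA + (I1 + I2 + kK) <= pA + pB + (a1 + (kK + K)))%E.
Proof.
move=> h1 h2; rewrite -[leRHS]addeA leeD2l// -addeA leeD//.
by rewrite [(kK + K)%E]addeC addeA leeD2r.
Qed.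

Lemma lee_chain_split (R : realType) (kA kB I1 I2 a1 : \bar R) :
  (kB <= I1 -> a1 <= I2 -> kA + kB + a1 <= kA + (I1 + I2))%E.
Proof. by move=> h1 h2; rewrite -addeA leeD2l// leeD. Qed.

Section grid.
Context (R : realType) d (T : measurableType d) (P : probability T R)
  (p : R -> R.-pker R ~> R) (X : R -> {RV P >-> R}) (c : R).
Hypothesis c01 : 0 < c < 1.
Hypothesis bp : bessel_transition_function (2 * c) p.
Hypothesis mkv : markov_process p X.
Hypothesis X0 : forall t w, 0 <= t -> 0 <= X t w.
Local Notation f := (beta_one_minus_pdf (1 - c)).
Hypothesis f_total : (\int[@lebesgue_measure R]_b (f b)%:E = 1)%E.
Implicit Types (s t h e : R) (k n : nat).

(** Stopping happens at the first grid point where [X < e]; this is the event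
    of not having stopped at the first [k] points. *)
Definition above t h e k : set T :=
  [set w | forall j, (j < k)%N -> e <= X (t + j%:R * h) w].

Lemma aboveS t h e k :
  above t h e k.+1 = above t h e k `&` X (t + k%:R * h) @^-1` `[e, +oo[.
Proof.
apply/seteqP; split => w /=.
  move=> H; split; last by rewrite /= in_itv/= andbT; exact: H.
  by move=> j jk; apply: H; exact: ltnW.
rewrite in_itv/= andbT => -[H1 H2] j; rewrite ltnS leq_eqVlt => /orP[/eqP ->//|].
exact: H1.
Qed.

Lemma above_filtration t h e k s : 0 <= t -> 0 <= h ->
  (forall j, (j < k)%N -> t + j%:R * h <= s) ->
  natural_filtration X s (above t h e k).
Proof.
move=> t0 h0; rewrite /natural_filtration.
set G := (X in <<s X >>).
elim: k => [|k IH] H.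
  have -> : above t h e 0 = setT by apply/seteqP; split.
  exact: (@measurableT _ (g_sigma_algebraType G)).
rewrite aboveS; apply: (@measurableI _ (g_sigma_algebraType G)).
  by apply: IH => j jk; apply: H; exact: ltnW.
apply: sub_sigma_algebra; exists (t + k%:R * h), `[e, +oo[%classic; split => //.
- by rewrite addr_ge0// mulr_ge0.
- exact: H.
Qed.

Lemma measurable_above t h e k : 0 <= t -> 0 <= h -> measurable (above t h e k).
Proof.
move=> t0 h0; apply: (@natural_filtration_measurable _ _ _ _ X (t + k%:R * h)).
by apply: above_filtration => // j jk; rewrite lerD2l ler_wpM2r// ler_nat ltnW.
Qed.

(* [V] is the conditional probability of a zero before [s], as predicted at the
   k-th grid point; [a] is its mean over the paths that have not yet stopped. *)
Let V s t h k (w : T) : \bar R := gmix f (s - (t + k%:R * h)) (X (t + k%:R * h) w).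
Let a s t h e k : \bar R := (\int[P]_(w in above t h e k) V s t h k w)%E.

Let f0 := beta_pdf_ge0 R c.
Let mf := measurable_beta_pdf R c.
Let f_out := beta_pdf_eq0 R c.

Let V0 s t h k w : (0 <= V s t h k w)%E. Proof. exact: gmix_ge0. Qed.
Let mV s t h k : measurable_fun [set: T] (V s t h k).
Proof.
apply: (measurableT_comp (measurable_gmix R f mf f0 _)); exact: measurable_funPT.
Qed.

Let splitV s t h e k : 0 <= t -> 0 <= h ->
  (a s t h e k = \int[P]_(w in above t h e k `\` above t h e k.+1) V s t h k w +
    \int[P]_(w in above t h e k.+1) V s t h k w)%E.
Proof.
move=> t0 h0.
have m1 := measurable_above t h e k t0 h0.
have m2 := measurable_above t h e k.+1 t0 h0.
rewrite -ge0_integral_setU//.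
- by rewrite setUC setDUK// aboveS; exact: subIsetl.
- exact: measurableD.
- by apply: measurable_funTS; exact: mV.
- apply/disj_setPS.
  by move=> w [[]].
Qed.

Let aS s t h e k : 0 <= t -> 0 <= h -> 0 < s - (t + k.+1%:R * h) ->
  (a s t h e k.+1 = \int[P]_(w in above t h e k.+1)
    gmix_tail f h (s - (t + k.+1%:R * h)) (X (t + k%:R * h) w))%E.
Proof.
move=> t0 h0 r0.
have tk : 0 <= t + k%:R * h by rewrite addr_ge0// mulr_ge0.
rewrite /a /V.
have -> : t + k.+1%:R * h = t + k%:R * h + h by rewrite -natr1; ring.
rewrite (markov_integral R d T P p X mkv _ _ _ (gmix f (s - (t + k%:R * h + h))))//.
- apply: eq_integral => w _; apply: semigroup_gmix => //.
  + by move: r0; rewrite -natr1; lra.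
  + exact: X0.
- apply: above_filtration => // j; rewrite ltnS => jk.
  by rewrite lerD2l ler_wpM2r// ler_nat.
- exact: measurable_gmix.
- by move=> y; exact: gmix_ge0.
Qed.

Let compl_above t h e k : 0 <= t -> 0 <= h ->
  (P (~` above t h e k.+1) =
   P (~` above t h e k) + P (above t h e k `\` above t h e k.+1))%E.
Proof.
move=> t0 h0.
have m1 := measurable_above t h e k t0 h0.
have m2 := measurable_above t h e k.+1 t0 h0.
rewrite -measureU//.
- congr (P _); apply/seteqP; split => w /=.
    move=> H; have [A|A] := pselect (above t h e k w); [by right|by left].
  by move=> [H|[_ H]]// A; apply: H; move: A; rewrite aboveS => -[].
- exact: measurableC.
- exact: measurableD.
- by apply/seteqP; split => w // [H [A _]]; apply: H.
Qed.

Let a0E x s t h e : P [set w | X 0 w = x] = 1%E -> 0 <= t -> t < s -> 0 <= x ->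
  a s t h e 0 = gmix_tail f t (s - t) x.
Proof.
move=> Px t0 ts x0.
rewrite /a /V mul0r addr0.
have -> : above t h e 0 = setT by apply/seteqP; split.
have := markov_integral R d T P p X mkv 0 t setT (gmix f (s - t)) (lexx 0) t0.
rewrite add0r => -> //; last 3 first.
- exact: (@measurableT _ (g_sigma_algebraType _)).
- exact: measurable_gmix.
- by move=> y; exact: gmix_ge0.
have mx : measurable [set w | X 0 w = x].
  have m1 := measurable_set1 x.
  rewrite -[Y in measurable Y]setTI -[Y in _ `&` Y]/(X 0 @^-1` [set x]).
  exact: (measurable_funP (X 0)).
transitivity (\int[P]_w gmix_tail f t (s - t) x)%E; last first.
  rewrite integral_cst// [Y in (_ * Y)%E](_ : _ = 1%E) ?mule1//.
  exact: probability_setT.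
apply: ae_eq_integral => //.
- apply: (@measurableT_comp _ _ _ _ _ _
    (fun y => \int[p t y]_z gmix f (s - t) z)%E); last exact: measurable_funPT.
  apply: measurable_fun_integral_kernel.
  + by move=> U mU; exact: measurable_kernel.
  + by move=> y; exact: gmix_ge0.
  + exact: measurable_gmix.
- exists (~` [set w | X 0 w = x]); split.
  + exact: measurableC.
  + transitivity (1 - P [set w | X 0 w = x])%E; first exact: probability_setC.
    by rewrite Px subee.
  + move=> w /= H Xw; apply: H => _; rewrite Xw; apply: semigroup_gmix => //.
    by rewrite subr_gt0.
Qed.

(** At each step the paths that stop contribute at most their probability, and
    the others lose at most [exp (- e^2 / (2 h))].  The grid ends exactly at
    [s]; at its last point the remaining time is [h] and [gmix_far] applies. *)
Lemma grid_upper x s t h e n : P [set w | X 0 w = x] = 1%E -> 0 <= x ->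
  0 <= t -> 0 < h -> 0 <= e -> s = t + n.+1%:R * h ->
  (gmix_tail f t (s - t) x <=
   P (~` above t h e n.+1) + (n.+1%:R * expR (- (e ^+ 2 / (2 * h))))%:E)%E.
Proof.
move=> Px x0 t0 h0 e0 sE.
have h0' := ltW h0.
have ts : t < s by rewrite sE ltrDl mulr_gt0.
rewrite -(a0E x s t h e)//.
set K := expR _.
have mab k : measurable (above t h e k) by exact: measurable_above.
have remE k : (k <= n.+1)%N -> s - (t + k%:R * h) = (n.+1 - k)%:R * h.
  by move=> kn; rewrite natrB// sE; ring.
have rem0 k : (k <= n)%N -> 0 < s - (t + k%:R * h).
  move=> kn; rewrite remE; last exact: leqW.
  by rewrite mulr_gt0// ltr0n subn_gt0.
have near_part k : (k <= n)%N ->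
    (\int[P]_(w in above t h e k `\` above t h e k.+1) V s t h k w
    <= P (above t h e k `\` above t h e k.+1))%E.
  move=> kn; rewrite -[leRHS]mul1e -integral_cst; last exact: measurableD.
  apply: ge0_le_integral => //.
  - exact: measurableD.
  - by apply: measurable_funTS; exact: mV.
  - by move=> w _; apply: gmix_le1 => //; exact: rem0.
have cstK k : (\int[P]_(w in above t h e k) K%:E <= K%:E)%E.
  rewrite integral_cst// -[leRHS]mule1 lee_pmul ?lee_fin ?expR_ge0//.
  exact: probability_le1.
have aboveX k w : above t h e k.+1 w -> 0 <= e <= X (t + k%:R * h) w.
  by move=> H; rewrite e0; exact: H.
have far_last : (\int[P]_(w in above t h e n.+1) V s t h n w <= K%:E)%E.
  apply: le_trans (cstK n.+1); apply: ge0_le_integral => //.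
  - by apply: measurable_funTS; exact: mV.
  - move=> w /aboveX ex; rewrite /V remE ?leqnSn// subSnn mul1r.
    exact: gmix_far.
have far_part k : (k < n)%N ->
    (\int[P]_(w in above t h e k.+1) V s t h k w <= a s t h e k.+1 + K%:E)%E.
  move=> kn; rewrite aS//; last exact: rem0.
  set r := s - (t + k.+1%:R * h).
  have mtail : measurable_fun (above t h e k.+1)
      (fun w => gmix_tail f h r (X (t + k%:R * h) w)).
    apply: measurable_funTS; apply: measurableT_comp; last exact: measurable_funPT.
    exact: measurable_gmix_tail.
  apply: (@le_trans _ _ (\int[P]_(w in above t h e k.+1)
      (gmix_tail f h r (X (t + k%:R * h) w) + K%:E))%E).
    apply: ge0_le_integral.
    - exact: mab.
    - by move=> w _; exact: V0.
    - by apply: measurable_funTS; exact: mV.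
    - exact: emeasurable_funD.
    - move=> w /aboveX ex; rewrite /V.
      have -> : s - (t + k%:R * h) = r + h by rewrite /r -natr1; ring.
      by apply: gmix_le_tail => //; exact: rem0.
  rewrite ge0_integralD//.
  - by rewrite leeD2l.
  - by move=> w _; exact: gmix_tail_ge0.
  - by move=> w _; rewrite lee_fin expR_ge0.
have chain k : (k <= n)%N ->
    (a s t h e 0 <= P (~` above t h e k) + (a s t h e k + (k%:R * K)%:E))%E.
  elim: k => [_|k IH kn].
    by rewrite mul0r adde0 leeDr.
  have -> : (k.+1%:R * K)%:E = ((k%:R * K)%:E + K%:E)%E.
    by rewrite -EFinD; congr EFin; rewrite -natr1; ring.
  apply: (le_trans (IH (ltnW kn))).
  rewrite (compl_above t h e k t0 h0') (splitV s t h e k t0 h0').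
  apply: lee_chain; [exact: near_part (ltnW kn)|exact: far_part].
apply: (le_trans (chain n (leqnn n))).
have -> : (n.+1%:R * K)%:E = ((n%:R * K)%:E + K%:E)%E.
  by rewrite -EFinD; congr EFin; rewrite -natr1; ring.
rewrite (compl_above t h e n t0 h0') (splitV s t h e n t0 h0').
rewrite -[((n%:R * K)%:E + K%:E)%E]add0e.
by apply: lee_chain; [exact: near_part|rewrite add0e].
Qed.

(** The losses have the favourable sign.  The paths that stop contribute at
    least [kappa] times their probability because at least [eta] of time is
    left. *)
Lemma grid_lower x s t h e eta kappa n : P [set w | X 0 w = x] = 1%E -> 0 <= x ->
  0 <= t -> 0 <= h -> 0 < eta -> t + n%:R * h + eta <= s ->
  0 <= kappa -> (kappa%:E <= gmix f eta e)%E ->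
  (kappa%:E * P (~` above t h e n) <= gmix_tail f t (s - t) x)%E.
Proof.
move=> Px x0 t0 h0 eta0 sE k0 ke.
have ts : t < s.
  by apply: lt_le_trans sE; rewrite -addrA ltrDl ltr_wpDl// mulr_ge0.
rewrite -(a0E x s t h e)//.
have mab k : measurable (above t h e k) by exact: measurable_above.
have rem0 k : (k <= n)%N -> eta <= s - (t + k%:R * h).
  move=> kn; rewrite lerBrDl; apply: le_trans sE.
  by rewrite lerD2r lerD2l ler_wpM2r// ler_nat.
have near_part k : (k < n)%N ->
    (kappa%:E * P (above t h e k `\` above t h e k.+1) <=
     \int[P]_(w in above t h e k `\` above t h e k.+1) V s t h k w)%E.
  move=> kn; rewrite -integral_cst; last exact: measurableD.
  apply: ge0_le_integral.
  - exact: measurableD.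
  - by move=> w _; rewrite lee_fin.
  - exact: measurable_cst.
  - by apply: measurable_funTS; exact: mV.
  - move=> w [Nk]; rewrite aboveS => NN; apply: (le_trans ke).
    apply: gmix_anti => //; first by rewrite eta0 rem0// ltnW.
    have tk : 0 <= t + k%:R * h by rewrite addr_ge0// mulr_ge0.
    rewrite X0//= leNgt; apply/negP => /ltW eX; apply: NN; split => //=.
    by rewrite in_itv/= eX.
have far_part k : (k < n)%N ->
    (a s t h e k.+1 <= \int[P]_(w in above t h e k.+1) V s t h k w)%E.
  move=> kn; have r0 := lt_le_trans eta0 (rem0 _ kn).
  rewrite (aS s t h e k t0 h0 r0).
  set r := s - (t + k.+1%:R * h).
  have mtail : measurable_fun (above t h e k.+1)
      (fun w => gmix_tail f h r (X (t + k%:R * h) w)).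
    apply: measurable_funTS; apply: measurableT_comp; last exact: measurable_funPT.
    exact: measurable_gmix_tail.
  apply: ge0_le_integral.
  - exact: mab.
  - by move=> w _; exact: gmix_tail_ge0.
  - exact: mtail.
  - by apply: measurable_funTS; exact: mV.
  - move=> w _; rewrite /V.
    have -> : s - (t + k%:R * h) = r + h by rewrite /r -natr1; ring.
    exact: gmix_tail_le.
have chain k : (k <= n)%N ->
    (kappa%:E * P (~` above t h e k) + a s t h e k <= a s t h e 0)%E.
  elim: k => [_|k IH kn].
    have -> : ~` above t h e 0 = set0.
      by apply/seteqP; split => w // H; apply: H.
    by rewrite measure0 mule0 add0e.
  apply: le_trans (IH (ltnW kn)).
  rewrite (compl_above t h e k t0 h0) (splitV s t h e k t0 h0).
  rewrite (ge0_muleDr kappa%:E (measure_ge0 P _) (measure_ge0 P _)).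
  apply: lee_chain_split; [exact: near_part|exact: far_part].
apply: le_trans (chain n (leqnn n)).
by rewrite leeDl//; apply: integral_ge0 => w _; exact: V0.
Qed.
End grid.

Arguments above {R d T P}.

(** * Zeros of continuous paths seen on dyadic grids *)

Section paths.
Context (R : realType) d (T : measurableType d) (P : probability T R)
  (X : R -> {RV P >-> R}).
Hypothesis X0 : forall t w, 0 <= t -> 0 <= X t w.
Hypothesis Xc : forall w, {within `[0, +oo[, continuous (fun t => X t w)}.
Implicit Types (t u h e : R) (j k n : nat).

Lemma grid_bracket h v n : 0 <= v <= n.+1%:R * h ->
  exists2 k, (k < n.+1)%N & k%:R * h <= v <= k.+1%:R * h.
Proof.
elim: n => [|n IH] /andP[v0 vn].
  by exists 0%N => //; rewrite mul0r v0.
have [vn'|/ltW vn'] := leP v (n.+1%:R * h).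
  have [|k kn kv] := IH; first by rewrite v0.
  by exists k => //; exact: ltnW.
by exists n.+1 => //; rewrite vn'.
Qed.

Definition dyadic_mesh t u j : R := (u - t) / 2 ^+ j.

Definition grid_below t u e j : set T :=
  ~` above X t (dyadic_mesh t u j) e (2 ^ j)%N.

(** Dyadic grids are nested, so the events of this union increase with [j] and
    its probability is the limit of theirs. *)
Definition dips_below t u e : set T := \bigcup_j grid_below t u e j.

Lemma dyadic_mesh_ge0 t u j : t <= u -> 0 <= dyadic_mesh t u j.
Proof. by move=> tu; rewrite divr_ge0 ?subr_ge0// exprn_ge0. Qed.

Lemma dyadic_meshM t u j : (2 ^ j)%:R * dyadic_mesh t u j = u - t.
Proof. by rewrite /dyadic_mesh natrX mulrC divfK// expf_neq0. Qed.

Lemma measurable_grid_below t u e j : 0 <= t <= u -> measurable (grid_below t u e j).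
Proof.
move=> /andP[t0 tu]; apply: measurableC; apply: measurable_above => //.
exact: dyadic_mesh_ge0.
Qed.

Lemma measurable_dips_below t u e : 0 <= t <= u -> measurable (dips_below t u e).
Proof. by move=> tu; apply: bigcupT_measurable => j; exact: measurable_grid_below. Qed.

Lemma grid_belowP t u e j w : grid_below t u e j w <->
  exists2 k, (k < 2 ^ j)%N & X (t + k%:R * dyadic_mesh t u j) w < e.
Proof.
split=> [/existsNP[k /not_implyP[kj /negP]]|[k kj Xe] H].
  by rewrite -ltNge => Xe; exists k.
by have := H k kj; rewrite leNgt Xe.
Qed.

Lemma grid_below_nd t u e :
  {homo grid_below t u e : m n / (m <= n)%N >-> (m <= n)%O}.
Proof.
apply/nondecreasing_seqP => j; apply/subsetPset => w /grid_belowP[k kj Xk].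
apply/grid_belowP; exists k.*2; first by rewrite expnS mul2n ltn_double.
suff <- : k%:R * dyadic_mesh t u j = k.*2%:R * dyadic_mesh t u j.+1 by [].
by rewrite /dyadic_mesh exprS -muln2 natrM; field; rewrite expf_neq0.
Qed.

Lemma grid_point_mem t u j k : t <= u -> (k < 2 ^ j)%N ->
  t <= t + k%:R * dyadic_mesh t u j <= u.
Proof.
move=> tu kj; have h0 := dyadic_mesh_ge0 t u j tu.
rewrite lerDl mulr_ge0//= -lerBrDl -(dyadic_meshM t u j) ler_wpM2r// ler_nat.
exact: ltnW.
Qed.

Lemma zero_dips t u e w : 0 <= t <= u -> 0 < e ->
  (exists r, t <= r <= u /\ X r w = 0) -> dips_below t u e w.
Proof.
move=> /andP[t0 tu] e0 [r [/andP[tr ru] Xr]].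
have r0 : 0 <= r by exact: le_trans tr.
have /(_ e e0) : forall e, 0 < e -> \forall v \near r, 0 <= v -> `|X v w| < e.
  move=> e' e'0.
  have Xcr : X v w @[v --> within `[0, +oo[ (nbhs r)] --> X r w.
    have /subspace_continuousP := Xc w.
    by apply; rewrite /= in_itv/= r0.
  move: Xcr; rewrite Xr => /cvgr0Pnorm_lt/(_ e' e'0).
  rewrite near_withinE; apply: filterS => v /= Xv v0.
  by apply: Xv; rewrite in_itv/= v0.
move=> /nbhs_ballP[n /= n0 Hn].
have [j hj] : exists j, dyadic_mesh t u j < n.
  exists (Num.Def.archi_bound ((u - t) / n)).
  rewrite /dyadic_mesh ltr_pdivrMr ?exprn_gt0// mulrC -ltr_pdivrMr//.
  exact: upper_nthrootP.
exists j => //; apply/grid_belowP.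
have [m mE] : exists m, (2 ^ j = m.+1)%N.
  by exists (2 ^ j).-1; rewrite prednK// expn_gt0.
have [|k km /andP[k1 k2]] := grid_bracket (dyadic_mesh t u j) (r - t) m.
  by rewrite subr_ge0 tr/= -mE dyadic_meshM lerB.
exists k; first by rewrite mE.
have tk : 0 <= t + k%:R * dyadic_mesh t u j.
  by rewrite addr_ge0// mulr_ge0// dyadic_mesh_ge0.
apply: le_lt_trans (ler_norm _) _; apply: Hn => //.
rewrite /ball/=; move: k2; rewrite -natr1 mulrDl mul1r => k2.
by rewrite ger0_norm; lra.
Qed.

(** The minimum of the path over [[t, u]] is attained. *)
Lemma dips_zero t u w : 0 <= t <= u ->
  (forall i : nat, dips_below t u i.+1%:R^-1 w) -> exists r, t <= r <= u /\ X r w = 0.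
Proof.
move=> /andP[t0 tu] H.
have Xtu : {within `[t, u], continuous (fun v => X v w)}.
  apply: continuous_subspaceW (Xc w) => v /=; rewrite !in_itv/= andbT => /andP[tv _].
  exact: le_trans tv.
have [r] := EVT_min tu Xtu.
rewrite in_itv/= => rtu rmin; exists r; split => //.
have r0 : 0 <= r by case/andP: rtu => tr _; exact: le_trans tr.
apply/eqP; rewrite eq_le X0// andbT leNgt; apply/negP => Xr.
have [i] := ltr_add_invr Xr; rewrite add0r => iX.
have [j _ /grid_belowP[k kj Xk]] := H i.
have := rmin (t + k%:R * dyadic_mesh t u j).
rewrite in_itv/= grid_point_mem// => /(_ isT).
by rewrite leNgt (lt_trans Xk).
Qed.

Definition zero_in t u : set T := [set w | exists r, t <= r <= u /\ X r w = 0].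

Lemma zero_inE t u : 0 <= t <= u ->
  zero_in t u = \bigcap_i dips_below t u i.+1%:R^-1.
Proof.
move=> tu; apply/seteqP; split => w.
  by move=> zw i _; apply: zero_dips => //; rewrite invr_gt0.
by move=> H; apply: dips_zero => // i; exact: H.
Qed.

Lemma measurable_zero_in t u : 0 <= t <= u -> measurable (zero_in t u).
Proof.
move=> tu; rewrite zero_inE//; apply: bigcapT_measurable => i.
exact: measurable_dips_below.
Qed.

End paths.

Arguments dyadic_mesh {R}.
Arguments grid_below {R d T P}.
Arguments dips_below {R d T P}.
Arguments zero_in {R d T P}.

(** The inequality [v^2 / 2 <= exp v] at [v = C * 2^j] beats the number of steps. *)
Lemma dyadic_gauss_small (R : realType) (C e : R) : 0 < C -> 0 < e ->
  exists j, (2 ^ j)%:R * expR (- (C * (2 ^ j)%:R)) <= e.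
Proof.
move=> C0 e0.
pose M := 2 / (C ^+ 2 * e).
exists (Num.Def.archi_bound M); set j := Num.Def.archi_bound M.
have M2 : M < (2 ^ j)%:R by rewrite natrX; exact: upper_nthrootP.
have n0 : 0 < (2 ^ j)%:R :> R by rewrite ltr0n expn_gt0.
move: M2 n0; set n : R := (2 ^ j)%:R => M2 n0.
have Cn0 : 0 < C * n by rewrite mulr_gt0.
have sq : (C * n) ^+ 2 / 2 <= expR (C * n).
  apply: le_trans (@expR_ge1Dxn R (C * n) 1 (ltW Cn0)).
  by rewrite lerDr.
rewrite expRN ler_pdivrMr ?expR_gt0//.
apply: le_trans (_ : e * ((C * n) ^+ 2 / 2) <= _); last by rewrite ler_pM2l.
move: M2; rewrite /M ltr_pdivrMr ?mulr_gt0 ?exprn_gt0// => M2.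
have -> : e * ((C * n) ^+ 2 / 2) = n * (n * (C ^+ 2 * e)) / 2 by field.
by rewrite ler_pdivlMr// ler_pM2l// ltW.
Qed.

(** * Two-sided bounds for the probability of a zero *)

Section hitting.
Context (R : realType) d (T : measurableType d) (P : probability T R)
  (p : R -> R.-pker R ~> R) (X : R -> {RV P >-> R}) (c x : R).
Hypothesis c01 : 0 < c < 1.
Hypothesis bp : bessel_transition_function (2 * c) p.
Hypothesis mkv : markov_process p X.
Hypothesis X0 : forall t w, 0 <= t -> 0 <= X t w.
Hypothesis Xc : forall w, {within `[0, +oo[, continuous (fun t => X t w)}.
Hypothesis Px : P [set w | X 0 w = x] = 1%E.
Hypothesis x0 : 0 <= x.
Local Notation f := (beta_one_minus_pdf (1 - c)).
Hypothesis f_total : (\int[@lebesgue_measure R]_b (f b)%:E = 1)%E.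
Implicit Types (s t u e : R).

Let mf := measurable_beta_pdf R c.
Let f0 := beta_pdf_ge0 R c.
Let f_out := beta_pdf_eq0 R c.

Let cvg_dips t u e : 0 <= t <= u ->
  P (grid_below X t u e j) @[j --> \oo] --> P (dips_below X t u e).
Proof.
move=> tu; apply: nondecreasing_cvg_mu.
- by move=> j; exact: measurable_grid_below.
- exact: measurable_dips_below.
- exact: grid_below_nd.
Qed.

(** The gap [s - u] is the time left when stopping, and lets [e] be chosen so
    small that stopping is worth almost [1]. *)
Lemma zero_in_le t u s : 0 <= t <= u -> u < s ->
  (P (zero_in X t u) <= gmix_tail f t (s - t) x)%E.
Proof.
move=> tu us; have /andP[t0 tu'] := tu.
apply/lee_mul01Pr => // kappa /andP[k0 k1].
have su : 0 < s - u by rewrite subr_gt0.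
have [e e0 ke] := gmix_near0 R f mf f0 f_out f_total _ _ su k1.
have grid_le j : (P (grid_below X t u e j) <=
    kappa^-1%:E * gmix_tail f t (s - t) x)%E.
  rewrite lee_pdivlMl; last exact: k0.
  apply: (@grid_lower R d T P p X c c01 bp mkv X0 x s t _ e (s - u)) => //.
  - exact: dyadic_mesh_ge0.
  - by rewrite dyadic_meshM; lra.
  - exact: ltW.
rewrite -lee_pdivlMl//.
apply: (@le_trans _ _ (P (dips_below X t u e))).
  apply: le_measure; rewrite ?inE; [exact: measurable_zero_in|exact: measurable_dips_below|].
  by move=> w; exact: zero_dips.
have cv := cvg_dips t u e tu.
rewrite -(cvg_lim _ cv)//; apply: lime_le; first by apply/cvg_ex; eexists; exact: cv.
by apply: nearW => j; exact: grid_le.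
Qed.

Lemma zero_in_ge t s : 0 <= t -> t < s ->
  (gmix_tail f t (s - t) x <= P (zero_in X t s))%E.
Proof.
move=> t0 ts; have ts' : 0 <= t <= s by rewrite t0 ltW.
have dips e : 0 < e ->
    (gmix_tail f t (s - t) x <= P (dips_below X t s e))%E.
  move=> e0; apply/lee_addgt0Pr => del del0.
  have C0 : 0 < e ^+ 2 / (2 * (s - t)).
    by rewrite divr_gt0 ?exprn_gt0// mulr_gt0// subr_gt0.
  have [j hj] := dyadic_gauss_small R _ _ C0 del0.
  have [m mE] : exists m, (2 ^ j = m.+1)%N.
    by exists (2 ^ j).-1; rewrite prednK// expn_gt0.
  have h0 : 0 < dyadic_mesh t s j by rewrite divr_gt0 ?subr_gt0// exprn_gt0.
  have sE : s = t + m.+1%:R * dyadic_mesh t s j.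
    by rewrite -mE dyadic_meshM; ring.
  have := @grid_upper R d T P p X c c01 bp mkv X0 f_total x s t _ e m Px x0 t0 h0 (ltW e0) sE.
  rewrite -mE => /le_trans; apply; apply: leeD.
    apply: le_measure; rewrite ?inE.
    + exact: measurable_grid_below.
    + exact: measurable_dips_below.
    + by move=> w Hw; exists j.
  rewrite lee_fin; apply: le_trans hj.
  rewrite le_eqVlt; apply/orP; left; apply/eqP.
  congr (_ * expR (- _)).
  rewrite /dyadic_mesh natrX; field.
  by rewrite gt_eqF ?subr_gt0//= expf_neq0.
have cv : P (dips_below X t s i.+1%:R^-1) @[i --> \oo] -->
    P (zero_in X t s).
  rewrite zero_inE//; apply: nonincreasing_cvg_mu.
  - by rewrite ltey_eq fin_num_measure//; exact: measurable_dips_below.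
  - by move=> i; exact: measurable_dips_below.
  - by apply: bigcapT_measurable => i; exact: measurable_dips_below.
  - move=> m n mn; apply/subsetPset => w [j _ /grid_belowP[k kj Xk]].
    exists j => //; apply/grid_belowP; exists k => //; apply: lt_le_trans Xk _.
    by rewrite lef_pV2 ?posrE// ler_nat.
rewrite -(cvg_lim _ cv)//; apply: lime_ge; first by apply/cvg_ex; eexists; exact: cv.
by apply: nearW => i; apply: dips; rewrite invr_gt0.
Qed.

End hitting.

(** * The distribution function of the maximum ratio *)

Section beta_exponential.
Context (R : realType) d (T : measurableType d) (Q : probability T R)
  (A E : {RV Q >-> R}) (c x t : R).
Hypothesis c01 : 0 < c < 1.
Hypothesis x0 : 0 < x.
Hypothesis t0 : 0 <= t.
Local Notation f := (beta_one_minus_pdf (1 - c)).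
Local Notation rate := (x ^+ 2 / 2).
Local Notation leb := (@lebesgue_measure R).
Hypothesis dA : has_density A f.
Hypothesis dE : has_density E (exponential_pdf rate).
Hypothesis indep : independent_RV2 A E.
Implicit Types (s z : R).

Let mf := measurable_beta_pdf R c.
Let f0 := beta_pdf_ge0 R c.
Let f_out := beta_pdf_eq0 R c.

Let rate0 : 0 < rate. Proof. by rewrite divr_gt0 ?exprn_gt0. Qed.

Lemma beta_pdf_total : (\int[leb]_b (f b)%:E = 1)%E.
Proof. by rewrite -(dA _ measurableT); exact: probability_setT. Qed.

Lemma integral_beta (g : R -> \bar R) : measurable_fun [set: R] g ->
  (forall a, 0 <= g a)%E ->
  (\int[distribution Q A]_a g a = \int[leb]_a ((f a)%:E * g a))%E.
Proof.
move=> mg g0.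
rewrite (@ge0_integral_mixture _ _ _ _ _ (distribution Q A) leb setT
  (fun a : R => mscale (NngNum (f0 a)) (@dirac _ R a R)))//.
- apply: eq_integral => a _.
  by rewrite ge0_integral_mscale//= integral_dirac// diracT mul1e.
- move=> U mU; rewrite /= /mscale/=.
  apply: emeasurable_funM; first exact/measurable_EFinP.
  under eq_fun do rewrite diracE -indicE.
  by apply/measurable_EFinP; exact: measurable_indic.
- move=> U mU; transitivity (\int[leb]_(y in U) (f y)%:E)%E; first exact: dA.
  rewrite [LHS]integral_mkcond; apply: eq_integral => a _.
  rewrite patchE /= /mscale/= diracE.
  by case: ifPn => _; rewrite ?mule1// mule0.
Qed.

Let mpdf : measurable_fun [set: R] (EFin \o exponential_pdf rate).
Proof. by apply/measurable_EFinP; exact: measurable_exponential_pdf. Qed.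

Lemma exponential_le0 : distribution Q E `]-oo, 0] = 0%E.
Proof.
rewrite (dE _ (measurable_itv _)).
rewrite -integral_itv_bndo_bndc; last exact: measurable_funTS.
apply: integral0_eq => y; rewrite /= in_itv/= => y0.
by rewrite /exponential_pdf patchE memNset//= in_itv/= andbT; apply/negP; rewrite -ltNge.
Qed.

(** The complement of ]0, z[ is the form in which the event appears:
    [1 / E <= 1 / z] also holds for [E <= 0], because the inverse of [0] is
    [0], but such values are negligible. *)
Lemma exponential_tail z : 0 < z ->
  distribution Q E (~` `]0, z[) = (expR (- rate * z))%:E.
Proof.
move=> z0.
have mI : measurable (`]0, z[%classic : set R) by exact: measurable_itv.
have I : distribution Q E `]0, z[ = (1 - (expR (- rate * z))%:E)%E.
  rewrite dE// -exponential_prob_itv0c// /exponential_prob.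
  rewrite integral_itv_bndo_bndc; last exact: measurable_funTS.
  by rewrite integral_itv_obnd_cbnd//; exact: measurable_funTS.
have : distribution Q E (~` `]0%R, z[) = (1 - distribution Q E `]0%R, z[)%E.
  exact: probability_setC.
move=> ->; rewrite I; set u := expR _; change ((1%:E - (1%:E - u%:E))%E = u%:E).
by rewrite -!EFinB; congr EFin; ring.
Qed.

Lemma integral_joint (S : set (R * R)) : measurable S ->
  Q [set w | S (A w, E w)] = (\int[distribution Q A]_a distribution Q E (xsection S a))%E.
Proof.
move=> mS.
have mAE : measurable_fun [set: T] (fun w => (A w, E w)).
  by apply: measurable_fun_pair; exact: measurable_funPT.
have @mu : {measure set (R * R) -> \bar R}.
  by refine (pushforward Q (fun w => (A w, E w))).
transitivity (mu S); first by [].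
transitivity ((distribution Q A \x distribution Q E)%E S); last by [].
by apply/esym/product_measure_unique => // B C mB mC; exact: indep.
Qed.

Lemma measurable_max_ratio : measurable_fun [set: R * R]
  (fun ae : R * R => Num.max t (1 / ae.2) * (1 / ae.1)).
Proof.
have minv1 : measurable_fun [set: R] (fun a : R => 1 / a).
  by under eq_fun do rewrite div1r; exact: measurable_invr.
apply: measurable_funM; last exact: (measurableT_comp minv1).
by apply: measurable_maxr => //; exact: (measurableT_comp minv1).
Qed.

Lemma measurable_max_ratio_RV : measurable_fun [set: T]
  (fun w => Num.max t (1 / E w) * (1 / A w)).
Proof.
apply: (measurableT_comp measurable_max_ratio
  (_ : measurable_fun _ (fun w => (A w, E w)))).
by apply: measurable_fun_pair; exact: measurable_funPT.
Qed.

(** For [0 < a < 1], the event given [A = a] is empty if [s a < t], and reads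
    [E >= 1 / (s a)] otherwise, up to a null set. *)
Lemma max_ratio_cdf s : t < s ->
  Q [set w | Num.max t (1 / E w) * (1 / A w) <= s] = gmix_tail f t (s - t) x.
Proof.
move=> ts; have s0 : 0 < s by exact: le_lt_trans ts.
pose S : set (R * R) := [set ae | Num.max t (1 / ae.2) * (1 / ae.1) <= s].
have mS : measurable S.
  have := measurable_max_ratio measurableT _ (measurable_itv `]-oo, s]).
  by rewrite setTI; congr measurable; apply/seteqP; split => ae; rewrite /S/= in_itv.
rewrite -[LHS]/(Q [set w | S (A w, E w)]) integral_joint// integral_beta//; last first.
  exact: measurable_fun_xsection.
rewrite /gmix_tail subrK integral_itv_obnd_cbnd; last first.
  apply: measurable_funTS; apply/measurable_EFinP; apply: measurable_funM => //.
  exact: measurable_gauss_mass.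
rewrite [RHS]integral_mkcond; apply: eq_integral => a _.
rewrite patchE.
have [/andP[a0 a1]|a01] := boolP (0 < a < 1); last first.
  by rewrite f_out// mul0e; case: ifP => //; rewrite mul0r.
have sa0 : 0 < s * a by rewrite mulr_gt0.
case: ifPn => ta.
  rewrite inE/= in_itv/= andbT ler_pdivrMr// mulrC in ta.
  have -> : xsection S a = ~` `]0, (s * a)^-1[.
    apply/seteqP; split => e; rewrite /xsection/= inE /S/= in_itv/=.
      rewrite !div1r ler_pdivrMr// ge_max => /andP[_ ie] /andP[e0 es].
      move: es; rewrite ltNge => /negP; apply.
      by rewrite -[leRHS]invrK lef_pV2 ?posrE ?invr_gt0.
    move=> /negP; rewrite negb_and -!leNgt => es.
    rewrite !div1r ler_pdivrMr// ge_max ta/=.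
    case/orP: es => [e0|es]; first by rewrite (le_trans _ (ltW sa0))// invr_le0.
    by rewrite -[leRHS]invrK lef_pV2 ?posrE ?invr_gt0// (lt_le_trans _ es)// invr_gt0.
  rewrite exponential_tail ?invr_gt0// -EFinM; congr (_ * expR _)%:E.
  by field; rewrite !gt_eqF.
have -> : xsection S a = set0.
  apply/seteqP; split => // e; rewrite /xsection/= inE /S/=.
  rewrite !div1r ler_pdivrMr// ge_max => /andP[ta' _]; move: ta; rewrite notin_setE/=.
  by rewrite in_itv/= andbT ler_pdivrMr// mulrC.
by rewrite measure0 mule0.
Qed.

(** Almost surely [A < 1] and [E > 0], so the ratio exceeds [t]. *)
Lemma max_ratio_le_eq0 : Q [set w | Num.max t (1 / E w) * (1 / A w) <= t] = 0%E.
Proof.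
have mA : measurable (A @^-1` (~` `]0, 1[)).
  rewrite -[X in measurable X]setTI; apply: (measurable_funP A) => //.
  by apply: measurableC; exact: measurable_itv.
have mE : measurable (E @^-1` `]-oo, 0]).
  rewrite -[X in measurable X]setTI; apply: (measurable_funP E) => //.
have A0 : Q (A @^-1` (~` `]0, 1[)) = 0%E.
  rewrite -[LHS]/(distribution Q A (~` `]0, 1[)) dA; last first.
    by apply: measurableC; exact: measurable_itv.
  apply: integral0_eq => a /=; rewrite in_itv/= => /negP a01.
  by rewrite f_out.
apply/eqP; rewrite eq_le measure_ge0 andbT.
rewrite -[leRHS](adde0 0%E) -{1}A0 -exponential_le0.
apply: le_trans (measureU2 _ _ _) => //.
apply: le_measure; rewrite ?inE.
- have := measurable_max_ratio_RV measurableT _ (measurable_itv `]-oo, t]).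
  rewrite setTI (_ : _ @^-1` _ = [set w | Num.max t (1 / E w) * (1 / A w) <= t])//.
- exact: measurableU.
- move=> w /= H; have [/andP[A0' A1]|/negP A01] := boolP (0 < A w < 1); last first.
    by left; rewrite in_itv.
  right; rewrite in_itv/= leNgt; apply/negP => E0.
  move: H; rewrite !div1r leNgt => /negP; apply.
  have m0 : 0 < Num.max t (E w)^-1 by rewrite lt_max invr_gt0 E0 orbT.
  apply: (@le_lt_trans _ _ (Num.max t (E w)^-1)); first by rewrite le_max lexx.
  by rewrite ltr_pMr// invf_gt1.
Qed.

End beta_exponential.

(** * From distribution functions to laws *)

Section law.
Context (R : realType) d (T : measurableType d) d' (T' : measurableType d').

(** Right tails form a pi-system that generates the Borel sets. *)
Lemma eq_law_ereal (P : probability T R) (Q : probability T' R)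
    (Y : T -> \bar R) (Z : T' -> \bar R) :
  measurable_fun [set: T] Y -> measurable_fun [set: T'] Z ->
  (forall r : R, P [set w | (Y w <= r%:E)%E] = Q [set w | (Z w <= r%:E)%E]) ->
  same_distribution P Q Y Z.
Proof.
move=> mY mZ cdfE; split=> // B mB.
have mpre d1 (U : measurableType d1) (V : U -> \bar R) : measurable_fun [set: U] V ->
    forall C, measurable C -> measurable (V @^-1` C).
  by move=> mV C mC; rewrite -[X in measurable X]setTI; exact: mV.
have @mu : {measure set (\bar R) -> \bar R} by refine (pushforward P Y).
have @nu : {measure set (\bar R) -> \bar R} by refine (pushforward Q Z).
(* The right tails miss [-oo], so the whole space is added to get a cover. *)
pose G := [set setT] `|` @ErealGenOInfty.G R.
suff : mu B = nu B by [].
apply: (@measure_unique _ _ _ G (fun=> setT)) => //.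
- rewrite [LHS](ErealGenOInfty.measurableE R); apply/seteqP; split.
    apply: sub_smallest2r; [exact: smallest_sigma_algebra|by move=> C; right].
  apply: smallest_sub; first exact: smallest_sigma_algebra.
  move=> C [->|GC]; first exact: (@measurableT _ (g_sigma_algebraType _)).
  exact: sub_sigma_algebra.
- move=> C D [->|[r ->]] [->|[s ->]].
  + by left; rewrite setTI.
  + by right; exists s; rewrite setTI.
  + by right; exists r; rewrite setIT.
  + right; exists (Num.max r s); apply/seteqP; split => y /=; rewrite !in_itv/= !andbT.
      by move=> [ry sy]; rewrite EFin_max gt_max ry.
    by rewrite EFin_max gt_max => /andP[].
- by move=> _; left.
- by rewrite bigcup_const//; exists 0%N.
- move=> C [->|[r ->]].
    transitivity (P setT); first by [].
    transitivity (Q setT); last by [].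
    by transitivity (1%E : \bar R); rewrite ?probability_setT.
  have tail d1 (U : measurableType d1) (S : probability U R) (V : U -> \bar R) :
      measurable_fun [set: U] V ->
      S (V @^-1` `]r%:E, +oo[) = (1 - S [set w | (V w <= r%:E)%E])%E.
    move=> mV.
    have -> : V @^-1` `]r%:E, +oo[ = ~` [set w | (V w <= r%:E)%E].
      apply/seteqP; split => w /=; rewrite in_itv/= andbT.
        by rewrite ltNge => /negP.
      by move=> /negP; rewrite -ltNge.
    apply: probability_setC.
    have := mpre _ _ V mV _ (emeasurable_itv `]-oo, r%:E]).
    rewrite (_ : _ @^-1` _ = [set w | (V w <= r%:E)%E])//.
  transitivity (P (Y @^-1` `]r%:E, +oo[)); first by [].
  transitivity (Q (Z @^-1` `]r%:E, +oo[)); last by [].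
  by rewrite !tail// cdfE.
- move=> k; apply: (@le_lt_trans _ _ (P setT)); first by [].
  by rewrite probability_setT ltry.
Qed.

End law.

Section first_zero.
Context (R : realType) d (T : measurableType d) (P : probability T R)
  (X : R -> {RV P >-> R}).
Hypothesis X0 : forall t w, 0 <= t -> 0 <= X t w.
Hypothesis Xc : forall w, {within `[0, +oo[, continuous (fun t => X t w)}.
Implicit Types (t s : R).

(** If [X s] is positive it stays so on a neighbourhood of [s], hence zeros
    after [s] cannot accumulate at [s]. *)
Lemma first_zero_afterP t s w : 0 <= t <= s ->
  (first_zero_after X t w <= s%:E)%E <-> zero_in X t s w.
Proof.
move=> /andP[t0 ts]; split; last first.
  move=> [r [/andP[tr rs] Xr]]; apply: (@le_trans _ _ r%:E); last by rewrite lee_fin.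
  by apply: ereal_inf_lbound; exists r.
move=> inf_le; apply: contrapT => noz.
have s0 : 0 <= s by exact: le_trans ts.
have Xs : 0 < X s w.
  rewrite lt_neqAle X0// andbT eq_sym; apply/eqP => Xs; apply: noz.
  by exists s; rewrite ts lexx.
have Xcs : X v w @[v --> within `[0, +oo[ (nbhs s)] --> X s w.
  have /subspace_continuousP := Xc w.
  by apply; rewrite /= in_itv/= s0.
have : \forall v \near within `[0, +oo[%classic (nbhs s), 0 < X v w.
  exact: (cvgr_gt _ Xcs).
rewrite near_withinE => /nbhs_ballP[n /= n0 Hn].
suff : (s%:E < first_zero_after X t w)%E by rewrite ltNge inf_le.
apply: (@lt_le_trans _ _ (s + n)%:E); first by rewrite lte_fin ltrDl.
apply/ereal_infP => _ [r [tr Xr] <-].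
rewrite lee_fin leNgt; apply/negP => rn.
have [rs|sr] := leP r s; first by apply: noz; exists r; rewrite tr rs.
have := Hn r; rewrite /ball/= in_itv/= (le_trans t0 tr)/= Xr ltxx.
by move=> H; have // : false by apply: H => //; rewrite ltr0_norm; lra.
Qed.

Lemma first_zero_after_ge t w : (t%:E <= first_zero_after X t w)%E.
Proof. by apply/ereal_infP => _ [r [tr _] <-]; rewrite lee_fin. Qed.

Lemma first_zero_after_lt t s : s < t ->
  [set w | (first_zero_after X t w <= s%:E)%E] = set0.
Proof.
move=> st; apply/seteqP; split => w //= h.
have := le_trans (first_zero_after_ge t w) h.
by rewrite lee_fin leNgt st.
Qed.

Lemma first_zero_after_le t s : 0 <= t <= s ->
  [set w | (first_zero_after X t w <= s%:E)%E] = zero_in X t s.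
Proof. by move=> ts; apply/seteqP; split => w /first_zero_afterP; apply. Qed.

Lemma measurable_first_zero_after t : 0 <= t ->
  measurable_fun [set: T] (first_zero_after X t).
Proof.
move=> t0; apply: (measurability _ (ErealGenOInfty.measurableE R)) => _ /= [_ [r ->] <-].
rewrite setTI.
have -> : first_zero_after X t @^-1` `]r%:E, +oo[ =
    ~` [set w | (first_zero_after X t w <= r%:E)%E].
  apply/seteqP; split => w /=; rewrite in_itv/= andbT.
    by rewrite ltNge => /negP.
  by move=> /negP; rewrite -ltNge.
apply: measurableC; have [tr|rt] := leP t r.
  rewrite first_zero_after_le ?t0//; apply: measurable_zero_in => //.
  by rewrite t0.
by rewrite first_zero_after_lt.
Qed.

End first_zero.

Theorem theorem3 (R : realType) (delta x t : R)
    (d : measure_display) (T : measurableType d) (P : probability T R)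
    (X : R -> {RV P >-> R})
    (d' : measure_display) (T' : measurableType d') (Q : probability T' R)
    (A E : {RV Q >-> R}) :
  0 < delta -> delta < 2 -> 0 < x -> 0 <= t ->
  let alpha := 1 - delta / 2 in
  bessel_process delta x X ->
  has_density A (beta_one_minus_pdf alpha) ->
  has_density E (exponential_pdf (x ^+ 2 / 2)) ->
  independent_RV2 A E ->
  same_distribution P Q (first_zero_after X t)
    (fun w => (Num.max t (1 / E w) * (1 / A w))%:E).
Proof.
move=> delta0 delta2 x0 t0 alpha [X0 Xc Px [p [bp mkv]]] dA dE indep.
pose c := delta / 2.
have c01 : 0 < c < 1 by rewrite /c; apply/andP; split; lra.
have deltaE : delta = 2 * c by rewrite /c; field.
rewrite deltaE in bp.
have f_total := beta_pdf_total R _ _ _ A c dA.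
pose Zr w := Num.max t (1 / E w) * (1 / A w).
have mZr : measurable_fun [set: T'] Zr by exact: measurable_max_ratio_RV.
have mZle s : measurable [set w | Zr w <= s].
  have := mZr measurableT _ (measurable_itv `]-oo, s]).
  by rewrite setTI (_ : _ @^-1` _ = [set w | Zr w <= s]).
apply: eq_law_ereal.
- exact: measurable_first_zero_after.
- exact/measurable_EFinP.
move=> r; rewrite -[RHS]/(Q [set w | ((Zr w)%:E <= r%:E)%E]).
have -> : [set w | ((Zr w)%:E <= r%:E)%E] = [set w | Zr w <= r].
  by apply/seteqP; split => w /=; rewrite lee_fin.
have cdf s : t < s -> Q [set w | Zr w <= s] = gmix_tail (beta_one_minus_pdf (1 - c)) t (s - t) x.
  move=> ts.
  exact: (max_ratio_cdf R _ _ _ A E c x t).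
have cdf_t : Q [set w | Zr w <= t] = 0%E.
  exact: (max_ratio_le_eq0 R _ _ _ A E c x t).
have [tr|rt] := leP t r; last first.
  rewrite first_zero_after_lt// measure0; apply/esym/eqP.
  rewrite eq_le measure_ge0 andbT -cdf_t; apply: le_measure; rewrite ?inE//.
  by move=> w /=; lra.
rewrite first_zero_after_le ?t0//.
apply/eqP; rewrite eq_le; apply/andP; split; last first.
  have [tr'|rt] := ltP t r.
    by rewrite cdf//; apply: (zero_in_ge R d T P p X c x) => //; exact: ltW.
  have -> : r = t by apply/eqP; rewrite eq_le rt.
  by rewrite cdf_t measure_ge0.
have cv : Q [set w | Zr w <= r + i.+1%:R^-1] @[i --> \oo] --> Q [set w | Zr w <= r].
  have -> : [set w | Zr w <= r] = \bigcap_i [set w | Zr w <= r + i.+1%:R^-1].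
    apply/seteqP; split => w /=.
      by move=> Zw i _ /=; rewrite (le_trans Zw)// lerDl invr_ge0.
    move=> H; rewrite leNgt; apply/negP => /ltr_add_invr[i].
    by rewrite ltNge; move/negP; apply; exact: H.
  apply: nonincreasing_cvg_mu => //.
  - by rewrite ltey_eq fin_num_measure.
  - by apply: bigcapT_measurable.
  - move=> m n mn; apply/subsetPset => w /= /le_trans; apply.
    by rewrite lerD2l lef_pV2 ?posrE// ler_nat.
rewrite -(cvg_lim _ cv)//; apply: lime_ge; first by apply/cvg_ex; eexists; exact: cv.
apply: nearW => i.
have ri : r < r + i.+1%:R^-1 by rewrite ltrDl invr_gt0.
rewrite cdf; last exact: le_lt_trans ri.
apply: (zero_in_le R d T P p X c x) => //; first exact: ltW.
by rewrite t0.
Qed.
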